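(* Let $f_0,f_1$ be finitely supported probability distributions on $G$, endow $G$ with the $W_1$-orientation with respect to $(f_0,f_1)$, and let $((f_t),(g_t),(h_t))$ be a $W_{1,+}$-geodesic joining $f_0$ to $f_1$, with associated function $m$ (defined in the context). For vertices $x\le y$ and $t\in[0,1]$ define the distribution $\mathrm{Bin}_{(x,y),t}$ on $G$, supported on $\{z: x\le z\le y\}$, by $$\mathrm{Bin}_{(x,y),t}(z)=\frac{m(x,z,y)}{m(x,y)}\,\frac{d(x,y)!}{d(x,z)!\,d(z,y)!}\,t^{d(x,z)}(1-t)^{d(z,y)}\quad (x\le z\le y).$$ Then there exist functions $a,b:G\to\mathbb{R}$ such that for all $t\in[0,1]$ and $z\in G$, $$f_t(z)=\sum_{x\le y}\frac{m(x,y)}{d(x,y)!}\,a(x)\,b(y)\,\mathrm{Bin}_{(x,y),t}(z).$$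
   Context: $G$ is a connected, locally finite graph with graph distance $d$; paths, geodesics, $L(\gamma)$, $e_0,e_1$ as usual (a path $\gamma(0),\dots,\gamma(n)$ of adjacent vertices is a geodesic if $n=d(\gamma(0),\gamma(n))$). For probability distributions (nonnegative functions summing to 1) $f_0,f_1$: $\Pi_1(f_0,f_1)$ is the set of couplings minimizing $\sum d(x,y)\pi(x,y)$, with minimum $W_1(f_0,f_1)$, and $\mathcal{C}(f_0,f_1)$ the set of $(x,y)$ with $\pi(x,y)>0$ for some $\pi\in\Pi_1(f_0,f_1)$. $W_1$-orientation: for adjacent $x,y$, $x\to y$ iff some geodesic $\gamma$ with $(e_0(\gamma),e_1(\gamma))\in\mathcal{C}(f_0,f_1)$ has $\gamma(k)=x,\gamma(k+1)=y$. Oriented path: $\gamma(i)\to\gamma(i+1)$ for all $i$; $x\le y$ iff an oriented path (possibly of length $0$) goes from $x$ to $y$. $E(G)=\{(xy):x\to y\}$, $T(G)=\{(x_0x_1x_2):x_0\to x_1\to x_2\}$, $\mathcal{F}(x)=\{y:x\to y\}$, $\mathcal{E}(x)=\{y:y\to x\}$; $\nabla g(x_1)=\sum_{x_2\in\mathcal{F}(x_1)}g(x_1x_2)-\sum_{x_0\in\mathcal{E}(x_1)}g(x_0x_1)$ for $g$ on $E(G)$, $\nabla h(x_1x_2)=\sum_{x_3\in\mathcal{F}(x_2)}h(x_1x_2x_3)-\sum_{x_0\in\mathcal{E}(x_1)}h(x_0x_1x_2)$ for $h$ on $T(G)$. A $W_1$-geodesic is a family $(f_t)_{t\in[0,1]}$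 with $W_1(f_s,f_t)=|t-s|W_1(f_0,f_1)$. A $W_{1,+}$-geodesic is a $W_1$-geodesic $(f_t)$ from $f_0$ to $f_1$, differentiable in $t$, with families $g_t:E(G)\to\mathbb{R}$, $h_t:T(G)\to\mathbb{R}$ such that $\partial_tf_t=-\nabla g_t$, $\partial_tg_t=-\nabla h_t$, $g_t>0$ on $E(G)$, and $f_t(x_1)h_t(x_0x_1x_2)=g_t(x_0x_1)g_t(x_1x_2)$ on $T(G)$. Associated objects: for an oriented path $\gamma$ of length $n$ (write $\gamma_i=\gamma(i)$), $C_\gamma(t)=f_t(\gamma_0)$ if $n=0$, $g_t(\gamma_0\gamma_1)$ if $n=1$, and $\prod_{i=0}^{n-1}g_t(\gamma_i\gamma_{i+1})/\prod_{j=1}^{n-1}f_t(\gamma_j)$ if $n\ge2$. $\mathcal{A}=\{x:\mathcal{E}(x)=\emptyset\}$, $\mathcal{B}=\{x:\mathcal{F}(x)=\emptyset\}$; an oriented path is extremal if it starts in $\mathcal{A}$ and ends in $\mathcal{B}$. For $z_1\le\cdots\le z_p$, $m(z_1,\dots,z_p)=\sum_\gamma C_\gamma(0)$, summed over extremal oriented paths $\gamma$ for which there are indices $k_1\le\dots\le k_p$ with $\gamma(k_i)=z_i$ (for extremal $\gamma$, $C_\gamma(t)$ does not depend on $t$). *)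

(* Defs.v *)
From HB Require Import structures.
From mathcomp Require Import all_boot all_order all_algebra.
From mathcomp Require Import all_classical all_reals.
From mathcomp Require Import ereal esum.
Set Implicit Arguments. Unset Strict Implicit. Unset Printing Implicit Defensive.
Import Order.TTheory GRing.Theory Num.Theory.
Local Open Scope classical_set_scope.
Local Open Scope ring_scope.

Section Graph.
Variable V : choiceType.
(* The graph is given by adjacency lists (locally finite by construction). *)
Variable nbrs : V -> seq V.

Definition adj : rel V := fun x y => y \in nbrs x.

Definition simple_connected_graph : Prop :=
  [/\ forall x y, adj x y -> adj y x,
      forall x, ~~ adj x x,
      forall x, uniq (nbrs x) &
      forall x y, exists p : seq V, path adj x p /\ last x p = y].

(* A path gamma(0..n) is encoded as (x, p) : gamma(0) = x, gamma(i) = nth x (x :: p) i,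
   length n = size p, e_0 = x, e_1 = last x p. *)
Definition walk_len_pred (x y : V) : pred nat :=
  fun n => `[< exists p : seq V, [/\ path adj x p, last x p = y & size p = n] >].

(* graph distance: minimal length of a path (0 if none, which cannot happen
   for a connected graph) *)
Definition dist (x y : V) : nat :=
  match pselect (exists n, walk_len_pred x y n) with
  | left H => ex_minn H
  | right _ => 0%N
  end.

Definition geodesic (x : V) (p : seq V) : Prop :=
  path adj x p /\ size p = dist x (last x p).

Variable R : realType.

Definition prob_dist (f : V -> R) : Prop :=
  (forall x, 0 <= f x) /\ (\esum_(x in [set: V]) (f x)%:E = 1%E).

Definition fin_supp (f : V -> R) : Prop :=
  exists s : seq V, forall x, x \notin s -> f x = 0.

Definition coupling (f0 f1 : V -> R) (pi : V -> V -> R) : Prop :=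
  [/\ forall x y, 0 <= pi x y,
      forall x, \esum_(y in [set: V]) (pi x y)%:E = (f0 x)%:E &
      forall y, \esum_(x in [set: V]) (pi x y)%:E = (f1 y)%:E].

Definition cost (pi : V -> V -> R) : \bar R :=
  \esum_(q in [set: V * V]) ((dist q.1 q.2)%:R * pi q.1 q.2)%:E.

Definition W1 (f0 f1 : V -> R) : \bar R :=
  ereal_inf (cost @` [set pi | coupling f0 f1 pi]).

Definition Pi1 (f0 f1 : V -> R) : set (V -> V -> R) :=
  [set pi | coupling f0 f1 pi /\ cost pi = W1 f0 f1].

Definition Csupp (f0 f1 : V -> R) (x y : V) : Prop :=
  exists pi, Pi1 f0 f1 pi /\ 0 < pi x y.

Section Orientation.
Variables f0 f1 : V -> R.

Definition arrow (x y : V) : Prop :=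
  adj x y /\
  exists (u : V) (p : seq V) (k : nat),
    [/\ geodesic u p, Csupp f0 f1 u (last u p), (k < size p)%N,
        nth u (u :: p) k = x & nth u (u :: p) k.+1 = y].

Definition arrowb : rel V := fun x y => `[< arrow x y >].

Definition oriented (x : V) (p : seq V) : Prop := path arrowb x p.

Definition ole (x y : V) : Prop := exists p, oriented x p /\ last x p = y.

Definition nablaE (g : V -> V -> R) (x1 : V) : R :=
  \sum_(x2 <- nbrs x1 | arrowb x1 x2) g x1 x2
  - \sum_(x0 <- nbrs x1 | arrowb x0 x1) g x0 x1.

Definition nablaT (h : V -> V -> V -> R) (x1 x2 : V) : R :=
  \sum_(x3 <- nbrs x2 | arrowb x2 x3) h x1 x2 x3
  - \sum_(x0 <- nbrs x1 | arrowb x0 x1) h x0 x1 x2.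

Definition has_deriv01 (F F' : R -> R) : Prop :=
  forall t, 0 <= t <= 1 -> forall eps : R, 0 < eps -> exists2 delta : R, 0 < delta &
    forall s, 0 <= s <= 1 -> s != t -> `|s - t| < delta ->
      `|(F s - F t) / (s - t) - F' t| < eps.

Definition W1_geodesic (f : R -> V -> R) : Prop :=
  [/\ f 0 = f0, f 1 = f1,
      forall t, 0 <= t <= 1 -> prob_dist (f t) &
      forall s t, 0 <= s <= 1 -> 0 <= t <= 1 ->
        W1 (f s) (f t) = ((`|t - s|)%:E * W1 f0 f1)%E].

Definition W1plus_geodesic (f : R -> V -> R) (g : R -> V -> V -> R)
    (h : R -> V -> V -> V -> R) : Prop :=
  [/\ W1_geodesic f,
      forall z, has_deriv01 (fun t => f t z) (fun t => - nablaE (g t) z),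
      forall x y, arrow x y ->
        has_deriv01 (fun t => g t x y) (fun t => - nablaT (h t) x y),
      forall t x y, 0 <= t <= 1 -> arrow x y -> 0 < g t x y &
      forall t x0 x1 x2, 0 <= t <= 1 -> arrow x0 x1 -> arrow x1 x2 ->
        f t x1 * h t x0 x1 x2 = g t x0 x1 * g t x1 x2].

Variables (f : R -> V -> R) (g : R -> V -> V -> R).

Definition Cgam (t : R) (x : V) (p : seq V) : R :=
  match p with
  | [::] => f t x
  | _ => (\prod_(i < size p) g t (nth x (x :: p) i) (nth x (x :: p) i.+1))
         / (\prod_(1 <= j < size p) f t (nth x (x :: p) j))
  end.

Definition srcA (x : V) : Prop := forall y, ~ arrow y x.
Definition sinkB (x : V) : Prop := forall y, ~ arrow x y.

Definition extremal (x : V) (p : seq V) : Prop :=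
  [/\ oriented x p, srcA x & sinkB (last x p)].

Definition m2 (z1 z2 : V) : R :=
  \sum_(q \in [set q : V * seq V | extremal q.1 q.2 /\
      exists k1 k2, [/\ (k1 <= k2 <= size q.2)%N,
        nth q.1 (q.1 :: q.2) k1 = z1 & nth q.1 (q.1 :: q.2) k2 = z2]])
    Cgam 0 q.1 q.2.

Definition m3 (z1 z2 z3 : V) : R :=
  \sum_(q \in [set q : V * seq V | extremal q.1 q.2 /\
      exists k1 k2 k3, [/\ (k1 <= k2 <= k3)%N, (k3 <= size q.2)%N,
        nth q.1 (q.1 :: q.2) k1 = z1, nth q.1 (q.1 :: q.2) k2 = z2 &
        nth q.1 (q.1 :: q.2) k3 = z3]])
    Cgam 0 q.1 q.2.

Definition Bin (x y : V) (t : R) (z : V) : R :=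
  if `[< ole x z /\ ole z y >] then
    m3 x z y / m2 x y
    * ((dist x y)`!%:R / ((dist x z)`! * (dist z y)`!)%:R)
    * t ^+ dist x z * (1 - t) ^+ dist z y
  else 0.

End Orientation.
End Graph.

(* Main.v *)
Require Import Defs.
From HB Require Import structures.
From mathcomp Require Import all_boot all_order all_algebra.
From mathcomp Require Import finmap all_classical all_reals.
From mathcomp Require Import ereal esum topology normedtype derive.
From mathcomp Require Import ring lra zify.
Import Order.TTheory GRing.Theory Num.Theory.
Import numFieldNormedType.Exports.
Local Open Scope classical_set_scope.
Local Open Scope ring_scope.
Set Implicit Arguments. Unset Strict Implicit. Unset Printing Implicit Defensive.

(** Cyclical monotonicity of optimal couplings makes every oriented path a
    geodesic, so the orientation is a finite acyclic graph on which all paths from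
    [x] to [y] have length [d(x,y)].

    Put [v(z) = (sum_x g(xz)) / f(z)] and [u(z) = (sum_y g(zy)) / f(z)]. The equations
    of a W_{1,+}-geodesic say [g(xy)' = (v(x) - u(y)) g(xy)] and
    [f(z)' = (v(z) - u(z)) f(z)]. Telescoping along an oriented path from [z] to a
    sink gives a positive solution of [p(z)' = v(z) p(z)]; for [q = f / p] one then has
    [q(z)' = - u(z) q(z)] and [g(xy) = p(x) k(xy) q(y)] with [k] independent of time.
    Hence [p' = p k] and [q' = - k q] are nilpotent linear systems, whose solutions are
    polynomials with coefficients [M(x,z)], the sums over the paths from [x] to [z] of
    the products of [k]. As [C_gamma(0) = p_0(start) * (product of k) * q_0(end)] for
    extremal [gamma], the functions [m] factor as [m(x,y) = U(x) M(x,y) D(y)] and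
    [m(x,z,y) = U(x) M(x,z) M(z,y) D(y)], and [a = p_0 / U], [b = q_1 / D] work. *)

(** * Optimal couplings and the orientation *)

Section Distance.
Variables (V : choiceType) (nbrs : V -> seq V).

Lemma dist_le (x : V) (p : seq V) :
  path (adj nbrs) x p -> (dist nbrs x (last x p) <= size p)%N.
Proof.
move=> xp; rewrite /dist; case: pselect => [H|//].
by case: ex_minnP => n _; apply; apply/asboolP; exists p.
Qed.

Lemma dist0 (x : V) : dist nbrs x x = 0%N.
Proof. by apply/eqP; rewrite -leqn0 (@dist_le x [::]). Qed.

Lemma dist_walk (x y : V) : simple_connected_graph nbrs ->
  exists p, [/\ path (adj nbrs) x p, last x p = y & size p = dist nbrs x y].
Proof.
case=> _ _ _ conn; have [p0 [p0P p0y]] := conn x y.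
rewrite /dist; case: pselect => [H|]; last first.
  by case; exists (size p0); apply/asboolP; exists p0.
by case: ex_minnP => n /asboolP[p [? ? ?]] _; exists p.
Qed.

(** The ball of radius [n] about [u] as a list, which exists because adjacency is given by lists;
    repetitions are harmless, since only membership is used. *)
Fixpoint reach (n : nat) (u : V) : seq V :=
  if n is n'.+1 then u :: flatten [seq reach n' w | w <- nbrs u] else [:: u].

Lemma mem_reach (n : nat) (u : V) (p : seq V) :
  path (adj nbrs) u p -> (size p <= n)%N -> {subset u :: p <= reach n u}.
Proof.
elim: n u p => [|n IH] u [|w p] //=.
- by move=> _ _ x; rewrite !inE => ->.
- by move=> _ _ x; rewrite !inE => ->.
move=> /andP[uw wp]; rewrite ltnS => pn x; rewrite inE => /orP[/eqP ->|xp].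
  by rewrite inE eqxx.
rewrite inE; apply/orP; right; apply/flattenP; exists (reach n w).
  by apply/mapP; exists w.
exact: IH xp.
Qed.

End Distance.

Section Transport.
Variables (V : choiceType) (nbrs : V -> seq V) (R : realType).
Implicit Types (f : V -> R) (pi : V -> V -> R).

Lemma esum_seq (T : choiceType) (r : seq T) (a : T -> R) : uniq r ->
  (forall x, 0 <= a x) -> (forall x, x \notin r -> a x = 0) ->
  \esum_(x in [set: T]) (a x)%:E = (\sum_(x <- r) a x)%:E.
Proof.
move=> ur a0 ar; transitivity (\esum_(x in [set` r]) (a x)%:E).
  rewrite [RHS]esum_mkcond; apply: eq_esum => x _.
  by rewrite mem_setE; case: ifPn => // /ar ->.
rewrite esum_fset; [|exact: finite_seq|by move=> x _; rewrite lee_fin].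
by rewrite -fsbig_seq// sumEFin.
Qed.

Lemma esum_eq0 (T : choiceType) (a : T -> R) (x : T) :
  (forall x, 0 <= a x) -> \esum_(x in [set: T]) (a x)%:E = 0%E -> a x = 0.
Proof.
move=> a0 s0; apply/eqP; rewrite eq_le a0 andbT.
suff : ((a x)%:E <= 0)%E by rewrite lee_fin.
by rewrite -s0; apply: esum_ge; exists [set x]; rewrite ?fsbig_set1.
Qed.

Lemma eq_big_seq_supp (T : eqType) (r1 r2 : seq T) (a : T -> R) :
  uniq r1 -> uniq r2 -> (forall x, x \in r1 -> x \notin r2 -> a x = 0) ->
  (forall x, x \in r2 -> x \notin r1 -> a x = 0) ->
  \sum_(x <- r1) a x = \sum_(x <- r2) a x.
Proof.
move=> u1 u2 a12 a21.
rewrite (bigID (mem r2)) /= [X in _ + X]big_seq_cond [X in _ + X]big1 ?addr0; last first.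
  by move=> x /andP[]; exact: a12.
rewrite [RHS](bigID (mem r1)) /= [X in _ = _ + X]big_seq_cond [X in _ = _ + X]big1 ?addr0;
  last by move=> x /andP[]; exact: a21.
rewrite -big_filter -[RHS]big_filter; apply: perm_big.
by apply: uniq_perm; rewrite ?filter_uniq// => x; rewrite !mem_filter /= andbC.
Qed.

Variables (f0 f1 : V -> R) (T : seq V).
Hypothesis uT : uniq T.
Hypothesis f0T : forall x, x \notin T -> f0 x = 0.
Hypothesis f1T : forall x, x \notin T -> f1 x = 0.

Lemma coupling_supp pi x y : coupling f0 f1 pi ->
  ~~ ((x \in T) && (y \in T)) -> pi x y = 0.
Proof.
case=> pi0 pir pic; rewrite negb_and => /orP[/f0T fx|/f1T fy].
  by apply: (@esum_eq0 _ (pi x)) => //; rewrite pir fx.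
by apply: (@esum_eq0 _ (pi^~ y)) => //; rewrite pic fy.
Qed.

(** A vanishing marginal kills its whole row or column, so a coupling lives on pairs from [T] and
    its extended sums are finite real sums. *)
Lemma couplingP pi : coupling f0 f1 pi <->
  [/\ forall x y, 0 <= pi x y,
      forall x y, ~~ ((x \in T) && (y \in T)) -> pi x y = 0,
      forall x, \sum_(y <- T) pi x y = f0 x &
      forall y, \sum_(x <- T) pi x y = f1 y].
Proof.
split=> [cp|[p0 ps pr pc]].
  have [p0 pr pc] := cp; split=> // [x y|x|y]; first exact: coupling_supp cp.
    apply: EFin_inj; rewrite -pr (esum_seq uT)// => y yT.
    by apply: (coupling_supp cp); rewrite (negbTE yT) andbF.
  apply: EFin_inj; rewrite -pc (@esum_seq _ T (pi^~ y))// => x xT.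
  by apply: (coupling_supp cp); rewrite (negbTE xT).
split=> // [x|y].
  by rewrite (esum_seq uT) ?pr// => y yT; apply: ps; rewrite (negbTE yT) andbF.
by rewrite (@esum_seq _ T (pi^~ y)) ?pc// => x xT; apply: ps; rewrite (negbTE xT).
Qed.

Definition fcost pi : R := \sum_(x <- T) \sum_(y <- T) (dist nbrs x y)%:R * pi x y.

Lemma cost_fcost pi : coupling f0 f1 pi -> cost nbrs pi = (fcost pi)%:E.
Proof.
move=> cp; have [p0 ps _ _] := (couplingP pi).1 cp.
rewrite /cost (@esum_seq _ [seq (x, y) | x <- T, y <- T]
   (fun q => (dist nbrs q.1 q.2)%:R * pi q.1 q.2)).
- by rewrite big_allpairs.
- by apply: allpairs_uniq => // -[? ?] [? ?].
- by move=> q; rewrite mulr_ge0.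
- move=> [x y] xyT /=; rewrite ps ?mulr0//; apply: contra xyT => /andP[xT yT].
  by apply/allpairsP; exists (x, y).
Qed.

Lemma Pi1_le pi pi' : Pi1 nbrs f0 f1 pi -> coupling f0 f1 pi' ->
  fcost pi <= fcost pi'.
Proof.
move=> [cp cpW] cp'; rewrite -lee_fin -!cost_fcost// cpW /W1.
by apply: ereal_inf_lbound; exists pi'.
Qed.

End Transport.

(** * Cyclical monotonicity and the length of oriented paths *)

Section CyclicalMonotonicity.
Variables (V : choiceType) (nbrs : V -> seq V) (R : realType).
Variables (f0 f1 : V -> R).

Lemma sum_delta (T : seq V) (F : V -> R) (b : V) : uniq T -> b \in T ->
  \sum_(y <- T) F y * (y == b)%:R = F b.
Proof.
move=> uT bT; rewrite (bigD1_seq b)//= eqxx mulr1 big1 ?addr0// => y /negbTE ->.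
by rewrite mulr0.
Qed.

Lemma exists_lower_bound (I : finType) (F : I -> R) : (forall i, 0 < F i) ->
  exists2 e : R, 0 < e & forall i, e <= F i.
Proof.
move=> F0; exists (\big[Num.min/1]_i F i); last by move=> i; exact: bigmin_le_cond.
by elim/big_ind: _ => // x y x0 y0; rewrite lt_min x0.
Qed.

(* Lowering the mass of each [pi i] at [(u i, w i)] by [e], adding [e] at
   [(u (sigma i), w i)] and averaging over [i] gives a competitor. *)
Lemma cyclical_monotonicity (T : seq V) (I : finType) (u w : I -> V) (pi : I -> V -> V -> R)
    (sigma : I -> I) : uniq T ->
  (forall x, x \notin T -> f0 x = 0) -> (forall x, x \notin T -> f1 x = 0) ->
  injective sigma ->
  (forall i, Pi1 nbrs f0 f1 (pi i)) -> (forall i, 0 < pi i (u i) (w i)) ->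
  (\sum_i dist nbrs (u i) (w i) <= \sum_i dist nbrs (u (sigma i)) (w i))%N.
Proof.
move=> uT f0T f1T sI piP piu.
have [I0|I0] := posnP #|I|; first by rewrite big1// => i; have := card0_eq I0 i.
have cp i := (piP i).1; have cq i := (couplingP uT f0T f1T (pi i)).1 (cp i).
have uwT i : (u i \in T) && (w i \in T).
  apply: contraT => /(coupling_supp f0T f1T (cp i)) p0.
  by have := piu i; rewrite p0 ltxx.
have uT' i : u i \in T by case/andP: (uwT i).
have wT i : w i \in T by case/andP: (uwT i).
(* [e] lies below every mass [pi i (u i) (w i)], so lowering by [e] leaves nonnegative entries. *)
have [e e0 ei] := exists_lower_bound piu.
pose n : R := #|I|%:R; have n0 : 0 < n by rewrite ltr0n.
(* [D a b] is kept opaque so that [mulr_sumr] does not split its product. *)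
have [D DE] : exists D : V -> V -> V -> V -> R, forall a b x y, D a b x y = (x == a)%:R * (y == b)%:R.
  by eexists.
pose pi' x y := n^-1 * \sum_i (pi i x y - e * D (u i) (w i) x y
                               + e * D (u (sigma i)) (w i) x y).
have Drow a b x : b \in T -> \sum_(y <- T) D a b x y = (x == a)%:R.
  by move=> bT; under eq_bigr do rewrite DE; rewrite (sum_delta (fun=> (x == a)%:R)).
have Dcol a b y : a \in T -> \sum_(x <- T) D a b x y = (y == b)%:R.
  move=> aT; under eq_bigr do rewrite DE mulrC.
  by rewrite (sum_delta (fun=> (y == b)%:R)).
have Dcost a b : a \in T -> b \in T -> fcost nbrs T (D a b) = (dist nbrs a b)%:R.
  move=> aT bT; rewrite /fcost -[RHS](sum_delta (fun x => (dist nbrs x b)%:R) uT aT).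
  apply: eq_bigr => x _; rewrite -[RHS](sum_delta (fun y => (dist nbrs x y)%:R * (x == a)%:R) uT bT).
  by apply: eq_bigr => y _; rewrite DE mulrA.
have Dout a b x y : a \in T -> b \in T -> ~~ ((x \in T) && (y \in T)) -> D a b x y = 0.
  rewrite DE => aT bT; case: eqP => [->|]; case: eqP => [->|]; rewrite ?mul0r ?mulr0//.
  by rewrite aT bT.
have sE (F : I -> R) : \sum_i F (sigma i) = \sum_i F i.
  by rewrite [RHS](reindex_inj sI).
have cp' : coupling f0 f1 pi'.
  apply/(couplingP uT f0T f1T); split.
  - move=> x y; rewrite mulr_ge0 ?invr_ge0 ?(ltW n0)// sumr_ge0// => i _.
    rewrite addr_ge0//; last by rewrite !mulr_ge0 ?DE ?mulr_ge0// ltW.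
    rewrite subr_ge0 DE; have [-> /=|/= _] := eqVneq x; last first.
      by rewrite mul0r mulr0; have [+ _ _ _] := cq i; exact.
    have [-> /=|/= _] := eqVneq y; first by rewrite !mulr1.
    by rewrite !mulr0; have [+ _ _ _] := cq i; exact.
  - move=> x y xy; rewrite /pi' big1 ?mulr0// => i _; rewrite !Dout// !mulr0 subr0 addr0.
    by have [_ + _ _] := cq i; exact.
  (* Row sums: mass leaves row [u i] and enters row [u (sigma i)]; the balance holds only after
     summing over [i], by [sE]. *)
  - move=> x; rewrite -mulr_sumr exchange_big /=.
    under eq_bigr => i _.
      rewrite big_split /= sumrB -!mulr_sumr !Drow//.
      have [_ _ -> _] := cq i.
      over.
    rewrite big_split /= sumrB -!mulr_sumr (sE (fun i => (x == u i)%:R)) subrK.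
    by rewrite sumr_const -[_ *+ _]mulr_natl mulrA mulVf ?mul1r// gt_eqF.
  (* Column sums: both changes sit in column [w i] and cancel for each [i]. *)
  - move=> y; rewrite -mulr_sumr exchange_big /=.
    under eq_bigr => i _.
      rewrite big_split /= sumrB -!mulr_sumr !Dcol// subrK.
      have [_ _ _ ->] := cq i.
      over.
    by rewrite sumr_const -[_ *+ _]mulr_natl mulrA mulVf ?mul1r// gt_eqF.
have cost' : fcost nbrs T pi' = n^-1 * (\sum_i fcost nbrs T (pi i)
    - e * \sum_i (dist nbrs (u i) (w i))%:R
    + e * \sum_i (dist nbrs (u (sigma i)) (w i))%:R).
  rewrite !mulr_sumr -sumrB -big_split /= mulr_sumr.
  under [RHS]eq_bigr do rewrite -!Dcost//.
  rewrite {1}/fcost /pi'.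
  under [LHS]eq_bigr do under eq_bigr do rewrite mulrCA !mulr_sumr.
  under [LHS]eq_bigr do rewrite exchange_big.
  rewrite [LHS]exchange_big /=; apply: eq_bigr => i _.
  rewrite !mulr_sumr -sumrB -big_split /= mulr_sumr; apply: eq_bigr => x _.
  rewrite !mulr_sumr -sumrB -big_split /= mulr_sumr; apply: eq_bigr => y _.
  ring.
have le i : fcost nbrs T (pi i) <= fcost nbrs T pi' := Pi1_le uT f0T f1T (piP i) cp'.
(* Summing the optimality inequalities over [i] cancels the costs of the [pi i] and leaves [e] times
   the claim. *)
have : \sum_i fcost nbrs T (pi i) <= \sum_(i : I) fcost nbrs T pi' by exact: ler_sum.
rewrite sumr_const cost' -[_ *+ _]mulr_natl mulrA mulfV ?gt_eqF// mul1r.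
by rewrite -addrA lerDl addrC subr_ge0 ler_pM2l// -!natr_sum ler_nat.
Qed.

(** The geodesic is cut around the edge into a walk to [x] and a walk from [y], the form in which
    rerouted walks are concatenated; the successor on [size pb] counts the edge itself. *)
Lemma arrow_split (x y : V) : arrow nbrs f0 f1 x y ->
  exists u w pa pb, [/\ Csupp nbrs f0 f1 u w,
    path (adj nbrs) u pa /\ last u pa = x, path (adj nbrs) y pb /\ last y pb = w &
    (size pa + (size pb).+1)%N = dist nbrs u w].
Proof.
move=> [_ [u [p [k [[up sp] C kp <- <-]]]]].
exists u, (last u p), (take k p), (drop k.+1 p); split=> //=.
- split; first by move: up; rewrite -{1}(cat_take_drop k p) cat_path => /andP[].
  by rewrite (last_nth u) size_take kp -[u :: take k p]/(take k.+1 (u :: p)) nth_take.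
- have E : p = take k p ++ nth u (u :: p) k.+1 :: drop k.+1 p.
    by rewrite /= -drop_nth// cat_take_drop.
  split; last by rewrite [in RHS]E last_cat.
  by move: up; rewrite {1}E cat_path => /andP[_ /andP[_]].
- by rewrite -sp size_take kp size_drop; lia.
Qed.

Lemma oriented_path (x : V) (p : seq V) :
  oriented nbrs f0 f1 x p -> path (adj nbrs) x p.
Proof. by apply: sub_path => a b /asboolP[]. Qed.

(* The [i]-th edge of [p] lies on a geodesic from [u i] to [w i]. Rerouting
   [u (i + 1)] to [w i] cyclically saves the edges of [p] and costs one shortest walk
   from [x] to [last x p]. *)
Lemma oriented_dist (x : V) (p : seq V) :
  simple_connected_graph nbrs -> fin_supp f0 -> fin_supp f1 ->
  oriented nbrs f0 f1 x p -> size p = dist nbrs x (last x p).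
Proof.
move=> conn [s0 s0P] [s1 s1P] xp; apply/eqP; rewrite eqn_leq andbC dist_le ?oriented_path//=.
pose T := undup (s0 ++ s1).
have f0T z : z \notin T -> f0 z = 0.
  by rewrite mem_undup mem_cat negb_or => /andP[/s0P].
have f1T z : z \notin T -> f1 z = 0.
  by rewrite mem_undup mem_cat negb_or => /andP[_ /s1P].
case: p xp => [|y0 p0] // xp; set p := y0 :: p0 in xp *.
set n := size p0.
pose X := nth x (x :: p).
have /choice[D DP] : forall i : 'I_n.+1, exists D : V * V * seq V * seq V * (V -> V -> R),
    let: (u, w, pa, pb, pi) := D in
    [/\ Pi1 nbrs f0 f1 pi, 0 < pi u w, path (adj nbrs) u pa /\ last u pa = X i,
        path (adj nbrs) (X i.+1) pb /\ last (X i.+1) pb = w &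
        (size pa + (size pb).+1)%N = dist nbrs u w].
  move=> i; have : arrow nbrs f0 f1 (X i) (X i.+1).
    by apply/asboolP; move/(pathP x): xp; apply.
  by move=> /arrow_split[u [w [pa [pb [[pi [? ?]] ? ? ?]]]]]; exists (u, w, pa, pb, pi).
pose u i := (D i).1.1.1.1; pose w i := (D i).1.1.1.2.
pose a i := (D i).1.1.2; pose b i := (D i).1.2.
have {}DP i : [/\ Pi1 nbrs f0 f1 (D i).2, 0 < (D i).2 (u i) (w i),
    path (adj nbrs) (u i) (a i) /\ last (u i) (a i) = X i,
    path (adj nbrs) (X i.+1) (b i) /\ last (X i.+1) (b i) = w i &
    (size (a i) + (size (b i)).+1)%N = dist nbrs (u i) (w i)].
  by have := DP i; rewrite /u /w /a /b; case: (D i) => [[[[]]]].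
have [r [xr rl rs]] := dist_walk x (last x p) conn.
have := @cyclical_monotonicity T _ u w (fun i => (D i).2) (@ordS n.+1) (undup_uniq _) f0T f1T
  (@ordS_inj _) (fun i => let: And5 h _ _ _ _ := DP i in h)
  (fun i => let: And5 _ h _ _ _ := DP i in h).
(* The rerouted walk follows [a (i + 1)] to the vertex [X (i + 1)] and then [b i]. At the last index
   [ordS] returns to 0, and [r] leads from [x] to [last x p] in between. *)
have le : (\sum_i dist nbrs (u (ordS i)) (w i) <=
   \sum_(i < n.+1) (size (a (ordS i)) + size (b i)) + dist nbrs x (last x p))%N.
  rewrite big_ord_recr [in leqRHS]big_ord_recr -addnA leq_add//=.
    apply: leq_sum => i _; set j := widen_ord _ i.
    have [_ _ [uaP ual] _ _] := DP (ordS j); have [_ _ _ [bP <-] _] := DP j.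
    have E : X (ordS j) = X j.+1 by rewrite /= modn_small ?ltnS ?ltn_ord.
    by rewrite -E -ual -last_cat -size_cat; apply: dist_le; rewrite cat_path uaP ual E.
  have [_ _ [uaP ual] _ _] := DP (ordS ord_max); have [_ _ _ [bP <-] _] := DP ord_max.
  have E0 : X (ordS (@ord_max n)) = x by rewrite /= modnn.
  have E1 : X (@ord_max n).+1 = last x p by rewrite (last_nth x).
  rewrite E1 in bP *; rewrite addnAC -rs -rl -E0 -{1}ual -!last_cat -!size_cat catA.
  apply: dist_le; rewrite !cat_path uaP last_cat ual E0 xr rl /=.
  by rewrite bP.
move=> /leq_trans /(_ le); rewrite big_split /=.
have -> : (\sum_i size (a (ordS i)) = \sum_i size (a i))%N.
  by rewrite [RHS](reindex_inj (@ordS_inj n.+1)).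
(* Each [d(u i, w i)] counts one edge of [p]; these ones add up to [n + 1], the length of [p], and
   all other terms cancel. *)
under eq_bigr => i _ do (have [_ _ _ _ <-] := DP i; rewrite addnS -addn1).
by rewrite !big_split /= sum1_card card_ord -?addnA ?leq_add2l; lia.
Qed.

(** Optimal couplings charge only pairs of support points, so the geodesics that carry arrows start
    in a finite set and have bounded length. *)
Lemma arrow_finite : simple_connected_graph nbrs -> fin_supp f0 -> fin_supp f1 ->
  exists S : seq V, forall x y, arrow nbrs f0 f1 x y -> x \in S /\ y \in S.
Proof.
move=> conn [s0 s0P] [s1 s1P].
pose N := (\max_(u <- s0) \max_(w <- s1) dist nbrs u w)%N.
exists (flatten [seq reach nbrs N u | u <- s0]) => x y [_ [u [p [k [[up sp] C kp <- <-]]]]].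
have [pi [[cp _] piu]] := C.
have us : u \in s0.
  apply: contraT => /s0P f0u; have [p0 pr _] := cp.
  by move: piu; rewrite (@esum_eq0 _ _ (pi u)) ?ltxx// pr f0u.
have ws : last u p \in s1.
  apply: contraT => /s1P f1u; have [p0 _ pc] := cp.
  by move: piu; rewrite (@esum_eq0 _ _ (pi^~ (last u p)) u) ?ltxx// pc f1u.
have pN : (size p <= N)%N.
  rewrite sp; apply: (@leq_trans (\max_(w <- s1) dist nbrs u w)).
    exact: leq_bigmax_seq ws isT.
  exact: leq_bigmax_seq us isT.
have sub : {subset u :: p <= flatten [seq reach nbrs N u | u <- s0]}.
  move=> z /(mem_reach up pN) zr; apply/flattenP; exists (reach nbrs N u) => //.
  by apply/mapP; exists u.
by split; apply: sub; rewrite mem_nth//= ltnS// ltnW.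
Qed.

End CyclicalMonotonicity.

(** * One-sided derivatives on the unit interval *)

Section Derivative.
Variable R : realType.
Implicit Types (F K : R -> R) (t s : R).

Local Notation at01 t := (within [set s : R | 0 <= s <= 1 /\ s != t] (nbhs t)).

(** Gives access to the limit laws for filters. The filter is the punctured neighbourhood inside
    [[0, 1]], hence one-sided at the endpoints. *)
Lemma has_deriv01P F F' : has_deriv01 F F' <->
  forall t, 0 <= t <= 1 -> (F s - F t) / (s - t) @[s --> at01 t] --> F' t.
Proof.
split=> [dF t t01|dF t t01 e e0].
  apply/cvgrPdist_lt => e e0; have [d d0 dP] := dF t t01 e e0.
  rewrite near_withinE; apply/nbhs_ballP; exists d => //= s.
  by rewrite /ball /= distrC => st [s01 snt]; rewrite distrC; exact: dP.
move/cvgrPdist_lt: (dF t t01) => /(_ e e0).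
rewrite near_withinE => /nbhs_ballP[d /= d0 dP]; exists d => // s s01 snt st.
by rewrite distrC; apply: dP => //; rewrite /ball /= distrC.
Qed.

Lemma has_deriv01_cvg F F' t : has_deriv01 F F' -> 0 <= t <= 1 ->
  F s @[s --> at01 t] --> F t.
Proof.
move=> /has_deriv01P dF t01.
rewrite -[X in _ --> X]add0r -[X in _ --> X + _](mulr0 (F' t)).
have st : (s - t) @[s --> at01 t] --> (0 : R).
  apply/cvgrPdist_lt => e e0; rewrite near_withinE; apply/nbhs_ballP.
  by exists e => //= s; rewrite /ball /= sub0r normrN distrC.
refine (cvg_trans _ (cvgD (cvgM (dF t t01) st) (cvg_cst (F t)))).
apply: near_eq_cvg; rewrite near_withinE; near=> s => -[_ snt].
by rewrite !fctE /= divfK ?subr_eq0// subrK.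
Unshelve. all: by end_near. Qed.

Lemma has_deriv01_eq F F' K K' : has_deriv01 F F' ->
  (forall t, 0 <= t <= 1 -> F t = K t) -> (forall t, 0 <= t <= 1 -> F' t = K' t) ->
  has_deriv01 K K'.
Proof.
move=> dF FK FK' t t01 e e0; have [d d0 dP] := dF t t01 e e0.
by exists d => // s s01 snt st; rewrite -!FK// -FK'//; exact: dP.
Qed.

Lemma has_deriv01_cst c : has_deriv01 (fun=> c : R) (fun=> 0).
Proof.
by move=> t t01 e e0; exists 1 => // s _ _ _; rewrite subrr mul0r subrr normr0.
Qed.

Lemma has_deriv01D F F' K K' : has_deriv01 F F' -> has_deriv01 K K' ->
  has_deriv01 (fun t => F t + K t) (fun t => F' t + K' t).
Proof.
move=> /has_deriv01P dF /has_deriv01P dK; apply/has_deriv01P => t t01.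
refine (cvg_trans _ (cvgD (dF t t01) (dK t t01))).
apply: near_eq_cvg; near=> s; rewrite !fctE /=; ring.
Unshelve. all: by end_near. Qed.

(** The increment of the product is [(F s - F t) * K s + F t * (K s - K t)], where continuity of [K]
    enters. *)
Lemma has_deriv01M F F' K K' : has_deriv01 F F' -> has_deriv01 K K' ->
  has_deriv01 (fun t => F t * K t) (fun t => F' t * K t + F t * K' t).
Proof.
move=> dF dK; apply/has_deriv01P => t t01.
have Kc := has_deriv01_cvg dK t01; move: dF dK => /has_deriv01P dF /has_deriv01P dK.
refine (cvg_trans _ (cvgD (cvgM (dF t t01) Kc) (cvgM (cvg_cst (F t)) (dK t t01)))).
apply: near_eq_cvg; near=> s; rewrite !fctE /=; ring.
Unshelve. all: by end_near. Qed.

Lemma has_deriv01Z c F F' : has_deriv01 F F' ->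
  has_deriv01 (fun t => c * F t) (fun t => c * F' t).
Proof.
move=> dF; apply: (has_deriv01_eq (has_deriv01M (has_deriv01_cst c) dF)) => // t _.
by rewrite mul0r add0r.
Qed.

Lemma has_deriv01_div F F' K K' : has_deriv01 F F' -> has_deriv01 K K' ->
  (forall t, 0 <= t <= 1 -> K t != 0) ->
  has_deriv01 (fun t => F t / K t) (fun t => F' t / K t - F t * K' t / K t ^+ 2).
Proof.
move=> dF dK K0; apply/has_deriv01P => t t01.
have Kc := has_deriv01_cvg dK t01; move: dF dK => /has_deriv01P dF /has_deriv01P dK.
have Kt := K0 t t01.
have <- : F' t * (K t)^-1 - F t / K t * K' t * (K t)^-1 =
  F' t / K t - F t * K' t / K t ^+ 2 by field.
refine (cvg_trans _ (cvgB (cvgM (dF t t01) (cvgV Kt Kc))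
  (cvgM (cvgM (cvg_cst (F t / K t)) (dK t t01)) (cvgV Kt Kc)))).
apply: near_eq_cvg; rewrite near_withinE; near=> s => -[s01 snt]; rewrite !fctE /=.
have Ks := K0 s s01; have {}snt : s - t != 0 by rewrite subr_eq0.
by field; rewrite snt Ks Kt.
Unshelve. all: by end_near. Qed.

Lemma has_deriv01_sum (I : Type) (r : seq I) (F F' : I -> R -> R) :
  (forall i, has_deriv01 (F i) (F' i)) ->
  has_deriv01 (fun t => \sum_(i <- r) F i t) (fun t => \sum_(i <- r) F' i t).
Proof.
move=> dF; elim: r => [|i r IH].
  by apply: (has_deriv01_eq (has_deriv01_cst 0)) => t _; rewrite big_nil.
by apply: (has_deriv01_eq (has_deriv01D (dF i) IH)) => t _; rewrite big_cons.
Qed.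

Lemma has_deriv01_X n : has_deriv01 (fun t => t ^+ n) (fun t => n%:R * t ^+ n.-1).
Proof.
have did : has_deriv01 (fun t : R => t) (fun=> 1).
  move=> t t01 e e0; exists 1 => // s _ snt _.
  by rewrite divff ?subr_eq0// subrr normr0.
elim: n => [|n IH].
  by apply: (has_deriv01_eq (has_deriv01_cst 1)) => // t _; rewrite mul0r.
apply: (has_deriv01_eq (has_deriv01M did IH)) => t _; first by rewrite exprS.
case: n {IH} => [|n] /=; first by rewrite mul0r mulr0 addr0.
by rewrite mulrCA -exprS mul1r -[in RHS]nat1r mulrDl mul1r.
Qed.

(** Time reversal serves to turn the equation [q' = - k q] into a forward system. *)
Lemma has_deriv01_rev F F' : has_deriv01 F F' ->
  has_deriv01 (fun t => F (1 - t)) (fun t => - F' (1 - t)).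
Proof.
move=> dF t t01 e e0; have t01' : 0 <= 1 - t <= 1 by lra.
have [d d0 dP] := dF _ t01' e e0; exists d => // s s01 snt st.
have s01' : 0 <= 1 - s <= 1 by lra.
have st' : 1 - s - (1 - t) = - (s - t) by ring.
have nst : 1 - s != 1 - t by apply: contra_neq snt => /subrI.
have := dP _ s01' nst; rewrite st' normrN invrN mulrN => /(_ st).
by rewrite -normrN; congr (`|_| < _); ring.
Qed.

(** The mean value theorem asks for a two-sided derivative only inside [(0, t)], and for continuity
    up to the endpoints, which the one-sided limits supply. *)
Lemma has_deriv01_0 F t : has_deriv01 F (fun=> 0) -> 0 <= t <= 1 -> F t = F 0.
Proof.
move=> dF /andP[t0 t1]; have [->//|tn0] := eqVneq t 0.
have {tn0}t0' : 0 < t by rewrite lt_neqAle eq_sym tn0.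
have [||c _] := @MVT R F (fun=> 0) 0 t t0'.
- move=> x; rewrite in_itv /= => /andP[x0 xt].
  have x01 : 0 <= x <= 1 by rewrite !ltW// (lt_le_trans xt).
  have dx : h^-1 *: ((F \o shift x) (h *: 1) - F x) @[h --> 0^'] --> (0 : R).
    apply/cvgrPdist_lt => e e0; rewrite near_withinE; apply/nbhs_ballP.
    have [d d0 dP] := dF x x01 e e0; have tx0 : 0 < t - x by rewrite subr_gt0.
    (* This radius keeps [h + x] between 0 and [t], so that [dP] applies to it. *)
    exists (Num.min d (Num.min x (t - x))); first by rewrite /= !lt_min d0 x0.
    move=> h; rewrite /ball /= sub0r normrN !lt_min => /and3P[hd hx htx] h0.
    have hn : h + x != x by rewrite -subr_eq0 addrK.
    have h01 : 0 <= h + x <= 1.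
      by move: hx htx; rewrite !ltr_norml => /andP[? ?] /andP[? ?]; lra.
    have := dP (h + x) h01 hn; rewrite addrK => /(_ hd).
    by rewrite subr0 sub0r normrN scaler1 mulrC.
  by apply: DeriveDef; [exact: cvgP dx|exact: cvg_lim dx].
- apply/subspace_continuousP => x; rewrite /= in_itv /= => /andP[x0 xt].
  have x01 : 0 <= x <= 1 by rewrite x0 (le_trans xt).
  apply/cvgrPdist_lt => e e0; rewrite near_withinE.
  have /cvgrPdist_lt /(_ e e0) := has_deriv01_cvg dF x01.
  rewrite near_withinE; apply: filterS => s sP /=; rewrite in_itv /= => /andP[s0 st].
  have [->|sx] := eqVneq s x; first by rewrite subrr normr0.
  by apply: sP; split; rewrite // s0 (le_trans st).
by rewrite mul0r => /eqP; rewrite subr_eq0 => /eqP.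
Qed.

End Derivative.

(** * Nilpotent linear systems with constant coefficients *)

Section LinearSystem.
Variables (V : choiceType) (R : realType) (S : seq V).
Variables (k M : V -> V -> R) (d : V -> V -> nat) (rk : V -> nat).
Hypothesis uS : uniq S.
Hypothesis M_tail : forall x z, z \in S ->
  M x z = (x == z)%:R + \sum_(w <- S) M x w * k w z.
Hypothesis d_refl : forall z, d z z = 0%N.
Hypothesis d_step : forall x w z, M x w * k w z != 0 -> d x z = (d x w).+1.
Hypothesis rk_lt : forall w z, k w z != 0 -> (rk w < rk z)%N.

(** The right-hand side solves the system: [M_tail] splits off the last arrow and [d_step] raises
    the exponent by one. Uniqueness is an induction on [rk], as the equation at [z] involves only
    vertices of smaller rank. [M] and [d] are abstract so that the transposed system is covered
    too. *)
Lemma linear_system (p : R -> V -> R) :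
  (forall z, z \in S ->
    has_deriv01 (fun t => p t z) (fun t => \sum_(w <- S) p t w * k w z)) ->
  forall t z, z \in S -> 0 <= t <= 1 ->
    p t z = \sum_(x <- S) p 0 x * M x z * (t ^+ d x z / (d x z)`!%:R).
Proof.
move=> dp.
pose T x z t := p 0 x * M x z * (t ^+ d x z / (d x z)`!%:R).
have TE x z t : z \in S -> T x z t = p 0 x * (x == z)%:R +
    \sum_(w <- S) p 0 x * (M x w * k w z) * (t ^+ d x z / (d x z)`!%:R).
  move=> zS; rewrite /T M_tail// mulrDr mulrDl; congr (_ + _).
    have [->|_] := eqVneq x z; last by rewrite mulr0 mul0r.
    by rewrite d_refl expr0 fact0 divr1 mulr1.
  by rewrite mulr_sumr mulr_suml.
have dT x z : z \in S ->
    has_deriv01 (T x z) (fun t => \sum_(w <- S) T x w t * k w z).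
  move=> zS.
  have dX n : has_deriv01 (fun t : R => t ^+ n.+1 / n.+1`!%:R) (fun t => t ^+ n / n`!%:R).
    apply: (has_deriv01_eq (has_deriv01Z (n.+1`!%:R^-1) (@has_deriv01_X R n.+1))) => t _.
      by rewrite mulrC.
    by rewrite /= factS natrM invfM mulrACA mulVf ?pnatr_eq0// mul1r mulrC.
  have dw w : has_deriv01
      (fun t => p 0 x * (M x w * k w z) * (t ^+ d x z / (d x z)`!%:R))
      (fun t => T x w t * k w z).
    have [Mk0|Mk] := eqVneq (M x w * k w z) 0.
      apply: (has_deriv01_eq (has_deriv01_cst 0)) => t _.
        by rewrite Mk0 mulr0 mul0r.
      transitivity (p 0 x * (M x w * k w z) * (t ^+ d x w / (d x w)`!%:R)).
        by rewrite Mk0 mulr0 mul0r.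
      rewrite /T; ring.
    rewrite (d_step Mk).
    apply: (has_deriv01_eq (has_deriv01Z (p 0 x * (M x w * k w z)) (dX (d x w)))) => // t _.
    rewrite /T; ring.
  have := has_deriv01D (has_deriv01_cst (p 0 x * (x == z)%:R)) (has_deriv01_sum S dw).
  move=> H; apply: (has_deriv01_eq H) => t _; first by rewrite TE.
  by rewrite add0r.
have T0 x z : z \in S -> T x z 0 = p 0 x * (x == z)%:R.
  move=> zS; rewrite TE// big1 ?addr0// => w _.
  have [->|Mk] := eqVneq (M x w * k w z) 0; first by rewrite mulr0 mul0r.
  by rewrite (d_step Mk) exprS !mul0r mulr0.
move=> t z; elim: {z}(rk z).+1 {-2}z (ltnSn (rk z)) t => // n IH z zn t zS t01.
have dpz := has_deriv01D (dp z zS)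
  (has_deriv01Z (-1) (has_deriv01_sum S (fun x => dT x z zS))).
have {}dpz : has_deriv01 (fun t => p t z - \sum_(x <- S) T x z t) (fun=> 0).
  apply: (has_deriv01_eq dpz) => s s01; first by rewrite mulN1r.
  rewrite mulN1r exchange_big /= -sumrB big_seq big1// => w wS.
  rewrite -mulr_suml -mulrBl; have [->|kwz] := eqVneq (k w z) 0; first by rewrite mulr0.
  by rewrite IH ?subrr ?mul0r//; apply: leq_trans (rk_lt kwz) _.
apply/eqP; rewrite -subr_eq0 (has_deriv01_0 dpz t01); apply/eqP.
under eq_bigr do rewrite T0//.
rewrite (bigD1_seq z)//= eqxx mulr1 big1 ?addr0 ?subrr// => x /negbTE ->.
by rewrite mulr0.
Qed.

End LinearSystem.

(** * Path sums *)

Lemma fsum_image2 (R : idomainType) (I J K : choiceType) (A : set I) (B : set J)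
    (phi : I -> J -> K) (F : I -> R) (G : J -> R) (H : K -> R) :
  finite_set A -> finite_set B ->
  (forall i j i' j', A i -> B j -> A i' -> B j' -> phi i j = phi i' j' ->
    i = i' /\ j = j') ->
  (forall i j, A i -> B j -> H (phi i j) = F i * G j) ->
  \sum_(c \in [set phi i j | i in A & j in B]) H c =
  (\sum_(i \in A) F i) * (\sum_(j \in B) G j).
Proof.
move=> fA fB phiI HE.
have -> : [set phi i j | i in A & j in B] = (fun q => phi q.1 q.2) @` (A `*` B).
  apply/seteqP; split=> [_ [i Ai [j Bj <-]]|_ [[i j] [Ai Bj] <-]].
    by exists (i, j).
  by exists i => //; exists j.
rewrite fsbig_image; last first.
  move=> [i j] [i' j'] /[!inE] -[/= Ai Bj] [/= Ai' Bj'].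
  by move=> /(phiI _ _ _ _ Ai Bj Ai' Bj')[-> ->].
transitivity (\sum_(q \in A `*` B) F q.1 * G q.2).
  by apply: eq_fsbigr => -[i j] /[!inE] -[/= Ai Bj]; exact: HE.
rewrite -(pair_fsbig _ (fun i j => F i * G j))// mulr_fsuml.
by apply: eq_fsbigr => i _; rewrite mulr_fsumr.
Qed.

Section PathSums.
Variables (V : choiceType) (R : realType) (e : rel V) (k : V -> V -> R).

Fixpoint weight (x : V) (p : seq V) : R :=
  if p is y :: p' then k x y * weight y p' else 1.

Lemma weight_cat x p1 p2 : weight x (p1 ++ p2) = weight x p1 * weight (last x p1) p2.
Proof. by elim: p1 x => [|y p1 IH] x /=; rewrite ?mul1r// IH mulrA. Qed.

Definition paths (x z : V) : set (seq V) := [set p | path e x p /\ last x p = z].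

Definition path_sum (x z : V) : R := \sum_(p \in paths x z) weight x p.

Variables (d : V -> V -> nat) (S : seq V).
Hypothesis eS : forall x y, e x y -> x \in S /\ y \in S.
Hypothesis ed : forall x p, path e x p -> size p = d x (last x p).
Hypothesis k_gt0 : forall x y, e x y -> 0 < k x y.
Hypothesis k_eq0 : forall x y, ~~ e x y -> k x y = 0.

Lemma weight_gt0 x p : path e x p -> 0 < weight x p.
Proof. by elim: p x => //= y p IH x /andP[xy yp]; rewrite mulr_gt0 ?k_gt0 ?IH. Qed.

Lemma path_sub x p : path e x p -> {subset p <= S}.
Proof.
elim: p x => //= y p IH x /andP[/eS[_ yS] yp] z.
by rewrite inE => /orP[/eqP ->//|]; exact: IH yp z.
Qed.

Lemma paths_out x z p : paths x z p -> z \in S -> x \in S.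
Proof. by case: p => [[_ /= ->]//|y p [/= /andP[/eS[]]]]. Qed.

Lemma finite_lists n : finite_set [set p : seq V | {subset p <= S} /\ (size p <= n)%N].
Proof.
elim: n => [|n IH].
  apply: (@sub_finite_set _ _ [set [::]]); last exact: finite_set1.
  by move=> p [_]; rewrite leqn0 => /nilP ->.
apply: (@sub_finite_set _ _ ([set [::]] `|`
   (fun q => q.1 :: q.2) @` ([set` S] `*` [set p : seq V | {subset p <= S} /\ (size p <= n)%N]))).
  move=> [|y p] [pS pn]; [by left|right]; exists (y, p) => //; split=> /=.
    by apply: pS; rewrite inE eqxx.
  by split=> // z zp; apply: pS; rewrite inE zp orbT.
rewrite finite_setU; split; first exact: finite_set1.
by apply: finite_image; apply: finite_setX => //; exact: finite_seq.
Qed.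

(** The length of a nonempty path is a value of [d] on [S], hence bounded, and there are finitely
    many lists over [S] of bounded length. *)
Lemma finite_paths x : finite_set [set p | path e x p].
Proof.
pose N := (\max_(x <- S) \max_(y <- S) d x y)%N.
apply: (sub_finite_set _ (finite_lists N)) => p xp; split; first exact: path_sub xp.
case: p xp => // y p xp; have xS : x \in S by case/andP: xp => /eS[].
rewrite (ed xp); apply: (@leq_trans (\max_(y <- S) d x y)).
  by apply: leq_bigmax_seq; rewrite // (path_sub xp) //= mem_last.
exact: leq_bigmax_seq xS isT.
Qed.

Lemma finite_paths_to x z : finite_set (paths x z).
Proof. by apply: sub_finite_set (finite_paths x) => p []. Qed.

Lemma path_sum_gt0 x z p : paths x z p -> 0 < path_sum x z.
Proof.
move=> xzp; rewrite lt_neqAle fsumr_ge0 ?andbT; last by move=> q [/weight_gt0/ltW].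
apply/eqP => /esym /pfsumr_eq0 H.
have := H (finite_paths_to x z) (fun q qP => ltW (weight_gt0 qP.1)) p xzp.
by apply/eqP; rewrite gt_eqF// weight_gt0; case: xzp.
Qed.

Lemma path_sum_neq0 x z : path_sum x z != 0 -> exists p, paths x z p.
Proof.
apply: contra_neqP => /forallNP H.
by rewrite /path_sum fsbig1// => p /H.
Qed.

Hypothesis uS : uniq S.

(** Paths are sorted by their first step; the empty path gives the identity term. *)
Lemma path_sum_head x z :
  path_sum x z = (x == z)%:R + \sum_(w <- S) k x w * path_sum w z.
Proof.
have fA := finite_paths_to x z.
rewrite /path_sum (fsbigID [set [::]])//; congr (_ + _).
  have [->|xz] := eqVneq x z.
    rewrite (_ : _ `&` _ = [set [::]]) ?fsbig_set1//.
    by apply/seteqP; split=> [p []//|p ->]; split.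
  rewrite (_ : _ `&` _ = set0) ?fsbig_set0//.
  by apply/seteqP; split=> // p [] /[swap] -> [_ /= /eqP]; rewrite (negbTE xz).
set A := _ `&` _; have {}fA : finite_set A by exact: finite_setIl.
have AE (p : seq V) : p \in fset_set A -> exists2 w, w \in S & exists2 p', p = w :: p' & e x w /\ paths w z p'.
  rewrite in_fset_set// inE => -[[xp pz] p0]; case: p xp pz p0 => [_ _ []//|w p].
  move=> /= /andP[xw wp] pz _; exists w; first by case: (eS xw).
  by exists p => //; split.
rewrite fsbig_finite//=.
(* An indicator sum over the first vertex is inserted before exchanging the sums; the default [x] of
   [head] is never reached, as the paths in [A] are nonempty. *)
transitivity (\sum_(p <- fset_set A) \sum_(w <- S) (if head x p == w then weight x p else 0)).
  rewrite big_seq [RHS]big_seq; apply: eq_bigr => p /AE[w wS [p' -> _]].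
  rewrite (bigD1_seq w)//= eqxx big1 ?addr0// => w' ww'.
  by rewrite eq_sym (negbTE ww').
rewrite exchange_big /=; apply: eq_bigr => w _.
rewrite -fsbig_finite// -/(path_sum w z).
have [xw|xw] := boolP (e x w); last first.
  rewrite k_eq0// mul0r fsbig1// => p Ap; case: eqP => // pw.
  have /AE[w' _ [p' pE [xw' _]]] : p \in fset_set A by rewrite in_fset_set// inE.
  by move: pw xw; rewrite pE /= => <-; rewrite xw'.
transitivity (\sum_(p \in A `&` [set p | head x p = w]) weight x p).
  rewrite [RHS]fsbig_mkcondr; apply: eq_fsbigr => p _.
  by case: eqP => pw; [rewrite mem_set|rewrite memNset].
have -> : A `&` [set p | head x p = w] = (cons w) @` paths w z.
  apply/seteqP; split=> [p [Ap pw]|_ [p [wp pz] <-]].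
    have /AE[w' _ [p' pE [xw' wp']]] : p \in fset_set A by rewrite in_fset_set// inE.
    by move: pw; rewrite pE /= => <-; exists p'.
  by do !split => //=; rewrite xw.
rewrite fsbig_image; last by move=> p q _ _ [].
by rewrite mulr_fsumr.
Qed.

Lemma sum_eq_mul (F : V -> R) (x : V) : (x \notin S -> F x = 0) ->
  \sum_(v <- S) (x == v)%:R * F v = F x.
Proof.
move=> Fx; have [xS|xS] := boolP (x \in S).
  rewrite (bigD1_seq x)//= eqxx mul1r big1 ?addr0// => v.
  by rewrite eq_sym => /negbTE ->; rewrite mul0r.
rewrite Fx// big_seq big1// => v vS; case: eqP => [xv|_]; last by rewrite mul0r.
by rewrite xv vS in xS.
Qed.

(** The length of a longest path leaving [x], since every path has length [d] of its ends; [rank_to]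
    does the same for paths arriving at [z]. Both serve as induction measures along arrows. *)
Definition rank_from (x : V) : nat := \max_(z <- S | `[< exists p, paths x z p >]) d x z.
Definition rank_to (z : V) : nat := \max_(x <- S | `[< exists p, paths x z p >]) d x z.

Lemma paths_size x z p : paths x z p -> size p = d x z.
Proof. by case=> xp <-; exact: ed. Qed.

Lemma path_step x w z p : paths x w p -> e w z -> paths x z (rcons p z).
Proof. by case=> xp pw wz; split; rewrite ?last_rcons// rcons_path xp pw. Qed.

Lemma path_step_head x w z p : e x w -> paths w z p -> paths x z (w :: p).
Proof. by move=> xw [wp pz]; split=> //=; rewrite xw. Qed.

Lemma rank_from_lt x w : e x w -> (rank_from w < rank_from x)%N.
Proof.
move=> xw; have [xS wS] := eS xw.
have d_le z p : z \in S -> paths w z p -> ((d w z).+1 <= rank_from x)%N.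
  move=> zS wzp; have xzp := path_step_head xw wzp.
  rewrite -(paths_size wzp) -[_.+1]/(size (w :: p)) (paths_size xzp).
  by apply: leq_bigmax_seq => //; apply/asboolP; exists (w :: p).
have r0 : (0 < rank_from x)%N by apply: leq_trans (d_le w [::] wS _).
rewrite -(prednK r0) ltnS; apply/bigmax_leqP_seq => z zS /asboolP[p wzp].
by rewrite -ltnS prednK// (d_le _ p).
Qed.

Lemma rank_to_lt w z : e w z -> (rank_to w < rank_to z)%N.
Proof.
move=> wz; have [wS zS] := eS wz.
have d_le x p : x \in S -> paths x w p -> ((d x w).+1 <= rank_to z)%N.
  move=> xS xwp; have xzp := path_step xwp wz.
  rewrite -(paths_size xwp) -(size_rcons p z) (paths_size xzp).
  by apply: leq_bigmax_seq => //; apply/asboolP; exists (rcons p z).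
have r0 : (0 < rank_to z)%N by apply: leq_trans (d_le w [::] wS _).
rewrite -(prednK r0) ltnS; apply/bigmax_leqP_seq => x xS /asboolP[p xwp].
by rewrite -ltnS prednK// (d_le _ p).
Qed.

Lemma k_neq0 x y : k x y != 0 -> e x y.
Proof. by apply: contraR => /k_eq0 ->. Qed.

(* With [M] the matrix of path sums, [M = 1 + k M] and [1 + M k] solves the same
   equation, whose solution is unique since [k] is nilpotent. *)
Lemma path_sum_tail x z :
  path_sum x z = (x == z)%:R + \sum_(w <- S) path_sum x w * k w z.
Proof.
elim: {x}(rank_from x).+1 {-2}x (ltnSn (rank_from x)) => // n IH x xn.
rewrite path_sum_head; congr (_ + _).
under [RHS]eq_bigr do rewrite path_sum_head mulrDl.
rewrite big_split /= (sum_eq_mul (F := k^~ z)); last first.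
  by move=> xS; apply: k_eq0; apply: contra xS => /eS[].
transitivity (\sum_(w <- S) k x w * ((w == z)%:R + \sum_(v <- S) path_sum w v * k v z)).
  apply: eq_bigr => w _; have [->|/k_neq0 xw] := eqVneq (k x w) 0; first by rewrite !mul0r.
  by rewrite IH//; apply: leq_trans (rank_from_lt xw) _.
under [LHS]eq_bigr do rewrite mulrDr; rewrite big_split /=; congr (_ + _).
  under [LHS]eq_bigr do rewrite mulrC eq_sym.
  by apply: sum_eq_mul => zS; apply: k_eq0; apply: contra zS => /eS[].
under [LHS]eq_bigr do rewrite mulr_sumr; rewrite exchange_big; apply: eq_bigr => v _ /=.
by rewrite mulr_suml; apply: eq_bigr => w _; rewrite mulrA.
Qed.

Lemma d_step_to x w z : path_sum x w * k w z != 0 -> d x z = (d x w).+1.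
Proof.
rewrite mulf_eq0 negb_or => /andP[/path_sum_neq0[p xwp] /k_neq0 wz].
by rewrite -(paths_size xwp) -(paths_size (path_step xwp wz)) size_rcons.
Qed.

Lemma d_step_from x w z : path_sum w z * k x w != 0 -> d x z = (d w z).+1.
Proof.
rewrite mulf_eq0 negb_or => /andP[/path_sum_neq0[p wzp] /k_neq0 xw].
by rewrite -(paths_size wzp) -(paths_size (path_step_head xw wzp)).
Qed.

Variables (A B : V -> Prop) (a0 b0 : V -> R).

(** The starting vertex varies and is kept with the list; for [outgoing] it is [z] itself. *)
Definition incoming (z : V) : set (V * seq V) := [set q | paths q.1 z q.2 /\ A q.1].
Definition outgoing (z : V) : set (seq V) := [set p | path e z p /\ B (last z p)].
Definition in_sum (z : V) : R := \sum_(q \in incoming z) a0 q.1 * weight q.1 q.2.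
Definition out_sum (z : V) : R := \sum_(p \in outgoing z) weight z p * b0 (last z p).

Lemma finite_outgoing z : finite_set (outgoing z).
Proof. by apply: sub_finite_set (finite_paths z) => p []. Qed.

Lemma finite_incoming z : finite_set (incoming z).
Proof.
pose N := (\max_(x <- S) d x z)%N.
apply: (@sub_finite_set _ _ ([set` z :: S] `*` [set p : seq V | {subset p <= S} /\ (size p <= N)%N])).
  move=> [x p] [/= xzp _]; split => /=.
    case: p xzp => [[_ /= ->]|y p [/= /andP[/eS[xS _] _] _]]; first by rewrite inE eqxx.
    by rewrite inE xS orbT.
  have [xp pz] := xzp; split; first exact: path_sub xp.
  case: p xzp xp {pz} => // y p xzp /andP[/eS[xS _] _].
  by rewrite (paths_size xzp); exact: leq_bigmax_seq xS isT.
by apply: finite_setX; [exact: finite_seq|exact: finite_lists].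
Qed.

(** All paths from [x] to [z] have length [d x z], so the cutting point of a concatenation is
    determined. This makes the gluing maps below injective. *)
Lemma paths_cat_inj x z p1 p2 p1' p2' : paths x z p1 -> paths x z p1' ->
  p1 ++ p2 = p1' ++ p2' -> p1 = p1' /\ p2 = p2'.
Proof.
move=> /paths_size s1 /paths_size s1' /eqP; rewrite eqseq_cat ?s1//.
by move=> /andP[/eqP -> /eqP ->].
Qed.

Lemma glue_paths x z (X : set (seq V)) : finite_set X ->
  \sum_(p \in [set p1 ++ p2 | p1 in paths x z & p2 in X]) weight x p * b0 (last x p) =
  path_sum x z * \sum_(p \in X) weight z p * b0 (last z p).
Proof.
move=> fX; apply: fsum_image2 => //; first exact: finite_paths_to.
  by move=> p1 p2 p1' p2' xzp1 _ xzp1' _; exact: paths_cat_inj xzp1 xzp1'.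
by move=> p1 p2 [_ zp1] _; rewrite weight_cat last_cat zp1 mulrA.
Qed.

Lemma glue_incoming z (X : set (seq V)) : finite_set X ->
  \sum_(q \in [set (q.1, q.2 ++ p) | q in incoming z & p in X])
    a0 q.1 * weight q.1 q.2 * b0 (last q.1 q.2) =
  in_sum z * \sum_(p \in X) weight z p * b0 (last z p).
Proof.
move=> fX; apply: fsum_image2 => //; first exact: finite_incoming.
  move=> [x p1] p2 [x' p1'] p2' [/= xzp1 _] _ [/= xzp1' _] _ [xx'].
  by rewrite -xx' in xzp1' * => /(paths_cat_inj xzp1 xzp1')[-> ->].
by move=> [x p1] p2 [[/= _ zp1] _] _; rewrite weight_cat last_cat zp1 !mulrA.
Qed.

Lemma finite_glue x z (X : set (seq V)) : finite_set X ->
  finite_set [set p1 ++ p2 | p1 in paths x z & p2 in X].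
Proof. by move=> fX; apply: finite_image2 => //; exact: finite_paths_to. Qed.

Lemma sum_through2 z1 z2 :
  \sum_(q \in [set (q.1, q.2 ++ p) | q in incoming z1 &
      p in [set p1 ++ p2 | p1 in paths z1 z2 & p2 in outgoing z2]])
    a0 q.1 * weight q.1 q.2 * b0 (last q.1 q.2) =
  in_sum z1 * (path_sum z1 z2 * out_sum z2).
Proof.
have fo := finite_outgoing.
by rewrite glue_incoming ?glue_paths//; exact: finite_glue.
Qed.

Lemma sum_through3 z1 z2 z3 :
  \sum_(q \in [set (q.1, q.2 ++ p) | q in incoming z1 &
      p in [set p1 ++ p2 | p1 in paths z1 z2 &
        p2 in [set p2 ++ p3 | p2 in paths z2 z3 & p3 in outgoing z3]]])
    a0 q.1 * weight q.1 q.2 * b0 (last q.1 q.2) =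
  in_sum z1 * (path_sum z1 z2 * (path_sum z2 z3 * out_sum z3)).
Proof.
have fo := finite_outgoing; have fg := finite_glue.
by rewrite glue_incoming ?glue_paths//; do ?apply: (fg).
Qed.

End PathSums.

(** * Time-independent factorization of the flow *)

(** Two solutions of the same scalar linear equation have a constant ratio. *)
Lemma has_deriv01_ratio (R : realType) (F G c : R -> R) :
  has_deriv01 F (fun t => c t * F t) -> has_deriv01 G (fun t => c t * G t) ->
  (forall t, 0 <= t <= 1 -> G t != 0) ->
  forall t, 0 <= t <= 1 -> F t = F 0 / G 0 * G t.
Proof.
move=> dF dG G0 t t01.
have dFG : has_deriv01 (fun t => F t / G t) (fun=> 0).
  apply: (has_deriv01_eq (has_deriv01_div dF dG G0)) => // s s01.
  by have Gs := G0 s s01; field.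
by rewrite -(has_deriv01_0 dFG t01) divfK// G0.
Qed.

Section Dynamics.
Variables (V : choiceType) (nbrs : V -> seq V) (R : realType) (f0 f1 : V -> R).
Variables (f : R -> V -> R) (g : R -> V -> V -> R) (h : R -> V -> V -> V -> R).
Hypothesis conn : simple_connected_graph nbrs.
Hypothesis f0fin : fin_supp f0.
Hypothesis f1fin : fin_supp f1.
Hypothesis fgh : W1plus_geodesic nbrs f0 f1 f g h.
Variable S : seq V.
Hypothesis uS : uniq S.
Local Notation e := (arrowb nbrs f0 f1).
Hypothesis eS : forall x y, e x y -> x \in S /\ y \in S.

Definition inflow t z : R := \sum_(x <- S | e x z) g t x z.
Definition outflow t z : R := \sum_(y <- S | e z y) g t z y.

Lemma sum_nbrs_to z (F : V -> R) :
  \sum_(x <- nbrs z | e x z) F x = \sum_(x <- S | e x z) F x.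
Proof.
have [sym _ un _] := conn.
rewrite -big_filter -[RHS]big_filter; apply: perm_big.
apply: uniq_perm; rewrite ?filter_uniq// => x; rewrite !mem_filter.
have [xz|] //= := boolP (e x z); have [-> _] := eS xz.
by have /asboolP[/sym] := xz.
Qed.

Lemma sum_nbrs_from z (F : V -> R) :
  \sum_(x <- nbrs z | e z x) F x = \sum_(x <- S | e z x) F x.
Proof.
have [_ _ un _] := conn.
rewrite -big_filter -[RHS]big_filter; apply: perm_big.
apply: uniq_perm; rewrite ?filter_uniq// => x; rewrite !mem_filter.
have [zx|] //= := boolP (e z x); have [_ ->] := eS zx.
by have /asboolP[] := zx.
Qed.

Lemma geod_ge0 t z : 0 <= t <= 1 -> 0 <= f t z.
Proof. by move=> t01; case: fgh => -[_ _ /(_ t t01)[]]. Qed.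

Lemma geod_df z : has_deriv01 (fun t => f t z) (fun t => inflow t z - outflow t z).
Proof.
case: fgh => _ /(_ z) df _ _ _; apply: (has_deriv01_eq df) => // t _.
by rewrite /nablaE sum_nbrs_to sum_nbrs_from opprB.
Qed.

Lemma geod_g_gt0 t x y : 0 <= t <= 1 -> e x y -> 0 < g t x y.
Proof. by move=> t01 /asboolP xy; case: fgh => _ _ _ g0 _; exact: g0. Qed.

(** The relation [f h = g g > 0] at the middle of two consecutive arrows excludes a zero of [f]. *)
Lemma geod_f_gt0 t x y z : 0 <= t <= 1 -> e x y -> e y z -> 0 < f t y.
Proof.
move=> t01 xy yz; rewrite lt_neqAle geod_ge0// andbT; apply/eqP => fy.
case: fgh => _ _ _ _ /(_ t x y z t01 (asboolW xy) (asboolW yz)).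
by rewrite -fy mul0r => /eqP; rewrite eq_sym gt_eqF// mulr_gt0// geod_g_gt0.
Qed.

(** [h] is eliminated through [h(zxy) = g(zx) g(xy) / f(x)]. If no arrow enters [x], or none leaves
    [y], the flow there is an empty sum and its quotient is 0 whatever the value of [f]. *)
Lemma geod_dg x y : e x y -> has_deriv01 (fun t => g t x y)
  (fun t => (inflow t x / f t x - outflow t y / f t y) * g t x y).
Proof.
move=> xy; case: fgh => _ _ /(_ x y (asboolW xy)) dg _ fh.
apply: (has_deriv01_eq dg) => // t t01.
rewrite /nablaT sum_nbrs_to sum_nbrs_from opprB mulrBl.
rewrite /inflow /outflow !mulr_suml; congr (_ - _); apply: eq_bigr => z zE.
  have fx := geod_f_gt0 t01 zE xy.
  have := fh t z x y t01 (asboolW zE) (asboolW xy).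
  by move=> H; rewrite mulrAC -H mulrAC mulfV ?mul1r// gt_eqF.
have fy := geod_f_gt0 t01 xy zE.
have := fh t x y z t01 (asboolW xy) (asboolW zE).
by move=> H; rewrite mulrAC [_ * g t x y]mulrC -H mulrAC mulfV ?mul1r// gt_eqF.
Qed.

Lemma nsinkP z : ~ sinkB nbrs f0 f1 z -> exists y, e z y.
Proof. by move=> /existsNP[y /contrapT zy]; exists y; apply/asboolP. Qed.

Lemma sink_e z y : sinkB nbrs f0 f1 z -> e z y = false.
Proof. by move=> zB; apply/asboolP/zB. Qed.

(** Either no arrow enters [z] and both sides are 0, or [f t z > 0] because an arrow also leaves
    [z]. *)
Lemma inflow_divK t z : 0 <= t <= 1 -> ~ sinkB nbrs f0 f1 z ->
  f t z * (inflow t z / f t z) = inflow t z.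
Proof.
move=> t01 /nsinkP[y zy]; rewrite /inflow mulr_suml mulr_sumr; apply: eq_bigr => x xz.
by rewrite mulrCA mulfV ?mulr1// gt_eqF// (geod_f_gt0 t01 xz zy).
Qed.

Lemma e_dist x p : path e x p -> size p = dist nbrs x (last x p).
Proof. exact: oriented_dist. Qed.

(** Let [v] and [u] be inflow and outflow divided by [f]. For an arrow from [z] to [y], [g(zy)] has
    logarithmic derivative [v(z) - u(y)]. If [y] is a sink, [u(y) = 0]; otherwise the factor
    [P_y / f(y)] contributes [v(y) - (v(y) - u(y)) = u(y)]. *)
Lemma exists_potential z : ~ sinkB nbrs f0 f1 z -> exists P : R -> R,
  (forall t, 0 <= t <= 1 -> 0 < P t) /\
  has_deriv01 P (fun t => inflow t z / f t z * P t).
Proof.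
pose rk := rank_from e (dist nbrs) S.
elim: {z}(rk z).+1 {-2}z (ltnSn (rk z)) => // n IH z zn /nsinkP[y zy].
have [yB|yB] := pselect (sinkB nbrs f0 f1 y).
  exists (fun t => g t z y); split=> [t t01|]; first exact: geod_g_gt0.
  apply: (has_deriv01_eq (geod_dg zy)) => // t t01.
  rewrite /outflow [X in _ - X / _]big1 ?mul0r ?subr0// => x.
  by rewrite sink_e.
have [P [P0 dP]] := IH y (leq_trans (rank_from_lt eS e_dist zy) zn) yB.
have [x yx] := nsinkP yB.
have fy t : 0 <= t <= 1 -> 0 < f t y by move=> t01; exact: geod_f_gt0 zy yx.
exists (fun t => g t z y * P t / f t y); split=> [t t01|].
  by rewrite divr_gt0 ?mulr_gt0 ?geod_g_gt0 ?P0 ?fy.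
apply: (has_deriv01_eq (has_deriv01_div (has_deriv01M (geod_dg zy) dP) (geod_df y) _)) => //.
  by move=> t t01; rewrite gt_eqF ?fy.
move=> t t01; have fy0 : f t y != 0 by rewrite gt_eqF ?fy.
set a := inflow t z / f t z; by field.
Qed.

(** The signs at time 0 control the sums over incoming and outgoing paths; at a sink only
    [0 <= p 0 z] is asked, as [p 0] may vanish there. *)
Definition factorization (p q : R -> V -> R) (k : V -> V -> R) : Prop :=
  [/\ (forall x y, e x y -> 0 < k x y) /\ (forall x y, ~~ e x y -> k x y = 0),
      forall t z, 0 <= t <= 1 -> f t z = p t z * q t z,
      forall t x y, 0 <= t <= 1 -> e x y -> g t x y = p t x * k x y * q t y,
      (forall z, has_deriv01 (fun t => p t z) (fun t => \sum_(w <- S) p t w * k w z)) /\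
      (forall z, has_deriv01 (fun t => q t z) (fun t => - \sum_(w <- S) q t w * k z w)) &
      [/\ forall z, 0 <= p 0 z, forall z, ~ sinkB nbrs f0 f1 z -> 0 < p 0 z &
          forall z, sinkB nbrs f0 f1 z -> 0 < q 0 z]].

Lemma exists_factorization : exists p q k, factorization p q k.
Proof.
have /choice[P PP] : forall z, exists P : R -> R, ~ sinkB nbrs f0 f1 z ->
    (forall t, 0 <= t <= 1 -> 0 < P t) /\
    has_deriv01 P (fun t => inflow t z / f t z * P t).
  move=> z; have [zB|/exists_potential[P PP]] := pselect (sinkB nbrs f0 f1 z).
    by exists (fun=> 0).
  by exists P.
pose B z := `[< sinkB nbrs f0 f1 z >].
(* At a sink no potential is available and the splitting [f = f * 1] is taken: no arrow leaves, so
   the derivative of [f] is the inflow, and the constant [q] fits its equation. *)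
pose p t z := if B z then f t z else P z t.
pose q t z := if B z then 1 else f t z / P z t.
pose k x y := if e x y then g 0 x y / (p 0 x * q 0 y) else 0.
have p_gt0 t z : 0 <= t <= 1 -> ~ sinkB nbrs f0 f1 z -> 0 < p t z.
  by move=> t01 zB; rewrite /p /B asboolF//; exact: (PP z zB).1.
have q_gt0 t x y : 0 <= t <= 1 -> e x y -> 0 < q t y.
  move=> t01 xy; rewrite /q /B; case: asboolP => // yB; have [z yz] := nsinkP yB.
  by rewrite divr_gt0 ?(geod_f_gt0 t01 xy yz)//; exact: (PP y yB).1.
have nB x y : e x y -> ~ sinkB nbrs f0 f1 x by move=> xy /(@sink_e x y); rewrite xy.
have fE t z : 0 <= t <= 1 -> f t z = p t z * q t z.
  move=> t01; rewrite /p /q /B; case: asboolP => zB; first by rewrite mulr1.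
  by rewrite mulrC divfK// gt_eqF//; exact: (PP z zB).1.
have dq0 z : has_deriv01 (fun t => q t z)
    (fun t => if B z then 0 else - (outflow t z / P z t)).
  rewrite /q /B; case: asboolP => zB; first exact: has_deriv01_cst.
  have [P0 dP] := PP z zB; have Pn t : 0 <= t <= 1 -> P z t != 0.
    by move=> t01; rewrite gt_eqF ?P0.
  apply: (has_deriv01_eq (has_deriv01_div (geod_df z) dP Pn)) => // t t01.
  have Pt := Pn t t01; rewrite mulrA inflow_divK//; by field.
(* [g(xy)] and [p(x) q(y)] solve the same linear equation, with coefficient [v(x) - u(y)], so their
   ratio keeps its value [k x y] at time 0. *)
have gE t x y : 0 <= t <= 1 -> e x y -> g t x y = p t x * k x y * q t y.
  move=> t01 xy; have xB := nB _ _ xy; have [P0 dP] := PP x xB.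
  have dpq : has_deriv01 (fun t => p t x * q t y)
      (fun t => (inflow t x / f t x - outflow t y / f t y) * (p t x * q t y)).
    rewrite /p /B asboolF//.
    apply: (has_deriv01_eq (has_deriv01M dP (dq0 y))) => // s s01.
    rewrite /q /B; case: asboolP => yB.
      by rewrite /outflow [X in _ - X / _]big1; [ring|move=> z; rewrite sink_e].
    have [z yz] := nsinkP yB; have fy := geod_f_gt0 s01 xy yz.
    have Py : 0 < P y s by exact: (PP y yB).1.
    set a := inflow s x / f s x; field; by rewrite !gt_eqF.
  have pq0 s : 0 <= s <= 1 -> p s x * q s y != 0.
    by move=> s01; rewrite gt_eqF// mulr_gt0 ?p_gt0// (q_gt0 _ _ _ s01 xy).
  rewrite (has_deriv01_ratio (geod_dg xy) dpq pq0 t01) /k xy; ring.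
have z01 : 0 <= (0 : R) <= 1 by rewrite lexx ler01.
exists p, q, k; split => //; last 1 first.
- split=> [z|z|z zB]; last by rewrite /q /B asboolT.
    have [zB|zB] := pselect (sinkB nbrs f0 f1 z); last exact/ltW/p_gt0.
    by rewrite /p /B asboolT// geod_ge0.
  exact: p_gt0.
- split=> x y; rewrite /k; last by move=> /negbTE ->.
  move=> xy; rewrite xy divr_gt0 ?geod_g_gt0// mulr_gt0 ?(q_gt0 _ _ _ z01 xy)//.
  exact/p_gt0/nB/xy.
have kN x y : ~~ e x y -> k x y = 0 by rewrite /k => /negbTE ->.
split=> z.
- have inE' t : 0 <= t <= 1 -> \sum_(w <- S) p t w * k w z * q t z = inflow t z.
    move=> t01; rewrite /inflow [RHS]big_mkcond; apply: eq_bigr => w _.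
    by case: ifPn => [wz|/kN ->]; rewrite ?mulr0 ?mul0r// gE.
  rewrite /p /B; case: asboolP => zB.
    apply: (has_deriv01_eq (geod_df z)) => // t t01.
    rewrite -inE'// /outflow [X in _ - X]big1 ?subr0; last by move=> x; rewrite sink_e.
    by apply: eq_bigr => w _; rewrite /q /B asboolT// mulr1.
  have [P0 dP] := PP z zB; have [y zy] := nsinkP zB.
  apply: (has_deriv01_eq dP) => // t t01.
  rewrite -inE'// !mulr_suml; apply: eq_bigr => w _.
  have [wz|/kN ->] := boolP (e w z); last by rewrite !mulr0 !mul0r.
  have fz := geod_f_gt0 t01 wz zy; have Pz := P0 t t01.
  rewrite [q t z]/q /B asboolF// /p /B; field; by rewrite !gt_eqF.
- apply: (has_deriv01_eq (dq0 z)) => // t t01.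
  rewrite {1}/B; case: asboolP => zB.
    by rewrite big1 ?oppr0// => w _; rewrite kN ?mulr0// sink_e.
  have [P0 dP] := PP z zB; congr (- _).
  rewrite /outflow mulr_suml big_mkcond; apply: eq_bigr => w _.
  case: ifPn => [zw|/kN ->]; last by rewrite mulr0.
  rewrite gE// [p t z]/p /B asboolF//; have Pz := P0 t t01.
  field; by rewrite gt_eqF.
Qed.

End Dynamics.

(** * The masses of the extremal paths *)

Section Through.
Variable V : eqType.
Implicit Types (x z : V) (p : seq V).

Lemma last_take x p n : (n <= size p)%N -> last x (take n p) = nth x (x :: p) n.
Proof.
move=> np; rewrite (last_nth x) size_takel//.
by rewrite -[x :: take n p]/(take n.+1 (x :: p)) nth_take.
Qed.

Lemma nth_size_cat x p1 p2 : nth x (x :: p1 ++ p2) (size p1) = last x p1.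
Proof. by rewrite -cat_cons nth_cat /= ltnSn -last_nth. Qed.

(** Visiting indices are traded for a cutting of the list into consecutive pieces, the form used in
    gluing. *)
Lemma through2P x p z1 z2 :
  (exists k1 k2, [/\ (k1 <= k2 <= size p)%N,
     nth x (x :: p) k1 = z1 & nth x (x :: p) k2 = z2]) <->
  (exists p1 p2 p3, [/\ p = p1 ++ p2 ++ p3, last x p1 = z1 & last z1 p2 = z2]).
Proof.
split=> [[k1 [k2 [/andP[k12 k2p] <- <-]]]|[p1 [p2 [p3 [-> <- <-]]]]].
  have k1p := leq_trans k12 k2p.
  exists (take k1 p), (take (k2 - k1) (drop k1 p)), (drop k2 p).
  rewrite -!last_take//; split=> //.
    by rewrite catA -takeD subnKC// cat_take_drop.
  by rewrite -last_cat -takeD subnKC.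
exists (size p1), (size (p1 ++ p2)); rewrite nth_size_cat; split=> //.
  by rewrite !size_cat; lia.
by rewrite catA nth_size_cat last_cat.
Qed.

Lemma through3P x p z1 z2 z3 :
  (exists k1 k2 k3, [/\ (k1 <= k2 <= k3)%N, (k3 <= size p)%N,
     nth x (x :: p) k1 = z1, nth x (x :: p) k2 = z2 & nth x (x :: p) k3 = z3]) <->
  (exists p1 p2 p3 p4, [/\ p = p1 ++ p2 ++ p3 ++ p4, last x p1 = z1,
     last z1 p2 = z2 & last z2 p3 = z3]).
Proof.
split=> [[k1 [k2 [k3 [/andP[k12 k23] k3p <- <- <-]]]]|[p1 [p2 [p3 [p4 [-> <- <- <-]]]]]].
  have k2p := leq_trans k23 k3p; have k1p := leq_trans k12 k2p.
  exists (take k1 p), (take (k2 - k1) (drop k1 p)), (take (k3 - k2) (drop k2 p)), (drop k3 p).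
  rewrite -!last_take//; split=> //.
  - by rewrite catA -takeD subnKC// catA -takeD subnKC// cat_take_drop.
  - by rewrite -last_cat -takeD subnKC.
  - by rewrite -last_cat -takeD subnKC.
exists (size p1), (size (p1 ++ p2)), (size ((p1 ++ p2) ++ p3)).
rewrite nth_size_cat; split=> //.
- by rewrite !size_cat; lia.
- by rewrite !size_cat; lia.
- by rewrite catA nth_size_cat last_cat.
- by rewrite catA (catA (p1 ++ p2)) nth_size_cat !last_cat.
Qed.

End Through.

(** Each inner vertex collects [Q] from the arrow entering it and [P] from the arrow leaving it;
    with [P Q = f] these products match the denominator of [Cgam]. *)
Lemma prod_factorization (V : choiceType) (R : realType) (e : rel V)
    (k g : V -> V -> R) (P Q : V -> R) (x0 x : V) (p : seq V) :
  (forall x y, e x y -> g x y = P x * k x y * Q y) -> path e x p -> p != [::] ->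
  \prod_(i < size p) g (nth x0 (x :: p) i) (nth x0 (x :: p) i.+1) =
  P x * weight k x p * Q (last x p) *
    \prod_(1 <= j < size p) (P (nth x0 (x :: p) j) * Q (nth x0 (x :: p) j)).
Proof.
move=> gE; elim: p x => // y [|z p] IH x xyp _.
  move: xyp => /= /andP[xy _].
  by rewrite big_ord1 big_geq//= gE// !mulr1.
have /andP[xy yp] : e x y && path e y (z :: p) by [].
rewrite big_ord_recl [in RHS]big_ltn// big_add1.
have /= -> := IH y yp isT.
rewrite gE//=; ring.
Qed.

Section PathMasses.
Variables (V : choiceType) (nbrs : V -> seq V) (R : realType) (f0 f1 : V -> R).
Variables (f : R -> V -> R) (g : R -> V -> V -> R) (h : R -> V -> V -> V -> R).
Variables (S : seq V) (p q : R -> V -> R) (k : V -> V -> R).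
Hypothesis conn : simple_connected_graph nbrs.
Hypothesis f0fin : fin_supp f0.
Hypothesis f1fin : fin_supp f1.
Hypothesis fgh : W1plus_geodesic nbrs f0 f1 f g h.
Local Notation e := (arrowb nbrs f0 f1).
Hypothesis eS : forall x y, e x y -> x \in S /\ y \in S.
Hypothesis uS : uniq S.
Hypothesis fac : factorization nbrs f0 f1 f g S p q k.

Local Notation A := (srcA nbrs f0 f1).
Local Notation B := (sinkB nbrs f0 f1).
Local Notation U := (in_sum e k A (p 0)).
Local Notation D := (out_sum e k B (q 0)).
Local Notation M := (path_sum e k).

Let ed := e_dist conn f0fin f1fin.

Let R01 : 0 <= (0 : R) <= 1.
Proof. by rewrite lexx ler01. Qed.

Lemma Cgam_extremal x r : extremal nbrs f0 f1 x r ->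
  Cgam f g 0 x r = p 0 x * weight k x r * q 0 (last x r).
Proof.
move=> [xr xA rB]; have [_ fE gE _ _] := fac.
case: r xr rB => [|y r] xr rB; first by rewrite /= mulr1 fE.
rewrite /Cgam (@prod_factorization _ _ e k (g 0) (p 0) (q 0)) //; last first.
  by move=> a b ab; rewrite gE.
rewrite -mulrA; under eq_bigr do rewrite -fE//.
(* The denominator is nonzero: an inner vertex has an arrow in and an arrow out, so [f] is positive
   there. *)
rewrite mulrA mulfK// prodf_seq_neq0; apply/allP => j.
rewrite mem_index_iota => /andP[j0 jr]; apply/implyP => _.
have /pathP path_e := xr; case: j j0 jr => // j _ jr.
by rewrite gt_eqF// (geod_f_gt0 fgh R01 (path_e x j (ltnW jr)) (path_e x j.+1 jr)).
Qed.

(** An extremal path is cut at [z1] and [z2] into an incoming path, a path between them and an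
    outgoing path, and the weights multiply. *)
Lemma m2E z1 z2 : m2 nbrs f0 f1 f g z1 z2 = U z1 * (M z1 z2 * D z2).
Proof.
rewrite -(sum_through2 k eS ed A B (p 0) (q 0)) /m2.
rewrite [X in \sum_(_ \in X) _ = _](_ : _ = [set (q.1, q.2 ++ p) | q in incoming e A z1 &
      p in [set p1 ++ p2 | p1 in paths e z1 z2 & p2 in outgoing e B z2]]); last first.
  apply/seteqP; split=> [[x r] /= [[xr xA rB] /through2P[p1 [p2 [p3 [rE l1 l2]]]]]|].
    move: xr rB; rewrite /oriented rE !cat_path !last_cat l1 l2 => /and3P[xp1 zp2 zp3] rB.
    exists (x, p1); first by split.
    by exists (p2 ++ p3) => //; exists p2 => //; exists p3.
  move=> _ [[x p1] /= [[xp1 l1] xA] [_ [p2 [zp2 l2] [p3 [zp3 rB] <-]] <-]].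
  split; last by apply/through2P; exists p1, p2, p3.
  by split=> //=; rewrite /oriented ?cat_path ?last_cat l1 l2 ?xp1 ?zp2.
apply: eq_fsbigr => _ /[!inE] -[[x p1] /= [[xp1 l1] xA] [_ [p2 [zp2 l2] [p3 [zp3 rB] <-]] <-]].
apply: Cgam_extremal; split=> //=.
  by rewrite /oriented !cat_path l1 l2 xp1 zp2.
by rewrite !last_cat l1 l2.
Qed.

Lemma m3E z1 z2 z3 :
  m3 nbrs f0 f1 f g z1 z2 z3 = U z1 * (M z1 z2 * (M z2 z3 * D z3)).
Proof.
rewrite -(sum_through3 k eS ed A B (p 0) (q 0)) /m3.
rewrite [X in \sum_(_ \in X) _ = _](_ : _ = [set (q.1, q.2 ++ p) | q in incoming e A z1 &
      p in [set p1 ++ p2 | p1 in paths e z1 z2 &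
        p2 in [set p2 ++ p3 | p2 in paths e z2 z3 & p3 in outgoing e B z3]]]); last first.
  apply/seteqP; split=> [[x r] /= [[xr xA rB] /through3P[p1 [p2 [p3 [p4 [rE l1 l2 l3]]]]]]|].
    move: xr rB; rewrite /oriented rE !cat_path !last_cat l1 l2 l3.
    move=> /and4P[xp1 zp2 zp3 zp4] rB.
    exists (x, p1); first by split.
    exists (p2 ++ p3 ++ p4) => //; exists p2 => //.
    by exists (p3 ++ p4) => //; exists p3 => //; exists p4.
  move=> _ [[x p1] /= [[xp1 l1] xA]
    [_ [p2 [zp2 l2] [_ [p3 [zp3 l3] [p4 [zp4 rB] <-]] <-]] <-]].
  split; last by apply/through3P; exists p1, p2, p3, p4.
  by split=> //=; rewrite /oriented ?cat_path ?last_cat l1 l2 l3 ?xp1 ?zp2 ?zp3.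
apply: eq_fsbigr => _ /[!inE] -[[x p1] /= [[xp1 l1] xA]
    [_ [p2 [zp2 l2] [_ [p3 [zp3 l3] [p4 [zp4 rB] <-]] <-]] <-]].
apply: Cgam_extremal; split=> //=.
  by rewrite /oriented !cat_path l1 l2 l3 xp1 zp2 zp3.
by rewrite !last_cat l1 l2 l3.
Qed.

(** Ranks decrease along arrows, so some path from [z] reaches a sink, and every term of the sum is
    positive. *)
Lemma out_sum_neq0 z : D z != 0.
Proof.
have [[k0 _] _ _ _ [_ _ q0]] := fac.
have [r rP] : exists r, outgoing e B z r.
  pose rk := rank_from e (dist nbrs) S.
  elim: {z}(rk z).+1 {-2}z (ltnSn (rk z)) => // n IH z zn.
  have [zB|zB] := pselect (B z); first by exists [::].
  have [y zy] := nsinkP zB.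
  have [r [yr rB]] := IH y (leq_trans (rank_from_lt eS ed zy) zn).
  by exists (y :: r); split=> //=; rewrite zy.
have pos s : outgoing e B z s -> 0 < weight k z s * q 0 (last z s).
  by move=> [zs sB]; rewrite mulr_gt0 ?q0// (weight_gt0 k0 zs).
apply/eqP => D0; have := pfsumr_eq0 (finite_outgoing eS ed B z) _ D0 rP.
by move=> /(_ (fun s sP => ltW (pos s sP))) /eqP; rewrite gt_eqF// pos.
Qed.

(* [U z] vanishes only at a vertex without arrows where [f 0] vanishes; there the
   quotient [p 0 z / U z] is the junk value [0]. *)
Lemma in_sum_eq0 z : U z = 0 -> p 0 z = 0.
Proof.
have [[k0 _] _ _ _ [p0 p0B _]] := fac => U0.
have [[x r] rP] : exists r, incoming e A z r.
  pose rk := rank_to e (dist nbrs) S.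
  elim: {z U0}(rk z).+1 {-2}z (ltnSn (rk z)) => // n IH z zn.
  have [zA|] := pselect (A z); first by exists (z, [::]).
  move=> /existsNP[y /contrapT yz]; have {}yz : e y z by apply/asboolP.
  have [[x r] [/= xyr xA]] := IH y (leq_trans (rank_to_lt eS ed yz) zn).
  by exists (x, rcons r z); split=> //=; exact: path_step xyr yz.
have nn s : incoming e A z s -> 0 <= p 0 s.1 * weight k s.1 s.2.
  by move=> [[xs _] _]; rewrite mulr_ge0// ltW// (weight_gt0 k0 xs).
have := pfsumr_eq0 (finite_incoming eS ed A z) nn U0 rP.
move=> /eqP; rewrite mulf_eq0; case: rP => -[/= xr xz] _.
rewrite (gt_eqF (weight_gt0 k0 xr)) orbF => /eqP p0x.
case: r xr xz => [|y r] xr xz; first by rewrite -xz.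
have xB : ~ B x by move=> /(_ y); apply; case/andP: xr => /asboolP.
by have := p0B x xB; rewrite p0x ltxx.
Qed.

(** In [f = p q], [p] is solved forward from time 0 and [q] backward from time 1. *)
Lemma mixture_factors t z : z \in S -> 0 <= t <= 1 ->
  f t z =
   (\sum_(x <- S) p 0 x * M x z * (t ^+ dist nbrs x z / (dist nbrs x z)`!%:R)) *
   (\sum_(y <- S) q 1 y * M z y * ((1 - t) ^+ dist nbrs z y / (dist nbrs z y)`!%:R)).
Proof.
have [[k0 kN] fE _ [dp dq] _] := fac => zS t01; rewrite fE//; congr (_ * _).
  apply: (@linear_system _ _ S k M (dist nbrs) (rank_to e (dist nbrs) S)) => //.
  - by move=> x w _; exact: path_sum_tail eS ed kN uS x w.
  - exact: dist0.
  - exact: d_step_to ed kN.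
  - by move=> w y /(k_neq0 kN); exact: rank_to_lt.
have t01' : 0 <= 1 - t <= 1 by lra.
(* In reversed time [q] is governed by the transpose of [k]; path sums and distances are transposed
   with it, and [rank_from] takes the place of [rank_to]. *)
have := @linear_system _ _ S (fun x y => k y x) (fun x y => M y x)
  (fun x y => dist nbrs y x) (rank_from e (dist nbrs) S) uS _ _ _ _
  (fun t => q (1 - t)) _ _ z zS t01'.
rewrite subKr subr0; apply.
- move=> x w _; rewrite (path_sum_head eS ed kN uS) eq_sym; congr (_ + _).
  by apply: eq_bigr => v _; rewrite mulrC.
- exact: dist0.
- move=> x w y; exact: (d_step_from ed kN).
- by move=> w y /(k_neq0 kN); exact: rank_from_lt.
- move=> y _; apply: (has_deriv01_eq (has_deriv01_rev (dq y))) => // s _.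
  by rewrite opprK.
Qed.

End PathMasses.

(** * Assembly of the mixture of binomial distributions *)

Theorem theorem3p15 (V : choiceType) (nbrs : V -> seq V) (R : realType)
    (f0 f1 : V -> R) (f : R -> V -> R) (g : R -> V -> V -> R)
    (h : R -> V -> V -> V -> R) :
  simple_connected_graph nbrs ->
  prob_dist f0 -> prob_dist f1 -> fin_supp f0 -> fin_supp f1 ->
  W1plus_geodesic nbrs f0 f1 f g h ->
  exists a b : V -> R, forall t : R, 0 <= t <= 1 -> forall z : V,
    f t z =
      \sum_(xy \in [set xy : V * V | ole nbrs f0 f1 xy.1 xy.2])
        (m2 nbrs f0 f1 f g xy.1 xy.2 / (dist nbrs xy.1 xy.2)`!%:R
         * a xy.1 * b xy.2 * Bin nbrs f0 f1 f g xy.1 xy.2 t z).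
Proof.
move=> conn _ _ f0fin f1fin fgh.
have [S0 S0P] := arrow_finite conn f0fin f1fin.
set e := arrowb nbrs f0 f1.
have eS0 x y : e x y -> x \in undup S0 /\ y \in undup S0.
  by move=> /asboolP; rewrite !mem_undup; exact: S0P.
have [p [q [k fac0]]] := exists_factorization conn f0fin f1fin fgh (undup_uniq S0) eS0.
pose U := in_sum e k (srcA nbrs f0 f1) (p 0).
pose D := out_sum e k (sinkB nbrs f0 f1) (q 0).
pose M := path_sum e k.
exists (fun x => p 0 x / U x), (fun y => q 1 y / D y) => t t01 z.
(* [z] may have no arrow and hence lie outside [S0]; [a] and [b] do not depend on [S]. *)
pose S := undup (z :: S0).
have uS : uniq S by exact: undup_uniq.
have eS x y : e x y -> x \in S /\ y \in S.
  by move=> /eS0; rewrite !mem_undup !inE => -[-> ->]; rewrite !orbT.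
have zS : z \in S by rewrite mem_undup inE eqxx.
(* Every arrow has both ends in [S0], so [k] vanishes at an added vertex and the sums keep their
   values. *)
have fac : factorization nbrs f0 f1 f g S p q k.
  have [[k0 kN] fE gE [dp dq] pq0] := fac0.
  split=> //; split=> x.
    apply: (has_deriv01_eq (dp x)) => // s _.
    apply: eq_big_seq_supp => //; first exact: undup_uniq.
      by move=> w; rewrite !mem_undup inE => ->; rewrite orbT.
    by move=> w _ wS; rewrite kN ?mulr0//; apply: contra wS => /eS0[].
  apply: (has_deriv01_eq (dq x)) => // s _; congr (- _).
  apply: eq_big_seq_supp => //; first exact: undup_uniq.
    by move=> w; rewrite !mem_undup inE => ->; rewrite orbT.
  by move=> w _ wS; rewrite kN ?mulr0//; apply: contra wS => /eS0[].
have [[k0 kN] _ _ _ _] := fac.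
have ed := e_dist conn f0fin f1fin.
rewrite (mixture_factors conn f0fin f1fin eS uS fac zS t01).
pose F x := p 0 x * M x z * (t ^+ dist nbrs x z / (dist nbrs x z)`!%:R).
pose G y := q 1 y * M z y * ((1 - t) ^+ dist nbrs z y / (dist nbrs z y)`!%:R).
(* Both sides are reduced to pairs with [x <= z <= y]: elsewhere a path sum vanishes on the left and
   [Bin] on the right. *)
pose C := [set xy : V * V | ole nbrs f0 f1 xy.1 z /\ ole nbrs f0 f1 z xy.2].
rewrite [LHS](_ : _ = \sum_(xy \in C) F xy.1 * G xy.2); last first.
  transitivity ((\sum_(x \in [set` S]) F x) * (\sum_(y \in [set` S]) G y)).
    by rewrite -!fsbig_seq.
  transitivity (\sum_(xy \in [set` S] `*` [set` S]) F xy.1 * G xy.2).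
    rewrite -(pair_fsbig _ (fun x y => F x * G y)) ?mulr_fsuml//; try exact: finite_seq.
    by apply: eq_fsbigr => x _; rewrite mulr_fsumr.
  apply/esym/fsbig_widen.
    move=> [x y] [/= [p1 [xp1 l1]] [p2 [zp2 l2]]]; split=> /=.
      exact: (paths_out eS (conj xp1 l1) zS).
    case: p2 zp2 l2 => [_ /= <- //|w p2] zp2 <-.
    by apply: (path_sub eS zp2); exact: (mem_last w p2).
  move=> [x y] [_ /not_andP nC] /=; rewrite /F /G.
  have [xz|] := pselect (ole nbrs f0 f1 x z); last first.
    move=> xz; have -> : M x z = 0; last by rewrite mulr0 !mul0r.
    by apply: contra_notP xz => /eqP /path_sum_neq0.
  have -> : M z y = 0; last by rewrite mulr0 mul0r mulr0.
  by case: nC => // zy; apply: contra_notP zy => /eqP /path_sum_neq0.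
transitivity (\sum_(xy \in C) (m2 nbrs f0 f1 f g xy.1 xy.2 / (dist nbrs xy.1 xy.2)`!%:R
         * (p 0 xy.1 / U xy.1) * (q 1 xy.2 / D xy.2) *
         Bin nbrs f0 f1 f g xy.1 xy.2 t z)); last first.
  apply: fsbig_widen => [[x y] [/= [p1 [xp1 l1]] [p2 [zp2 l2]]]|[x y] [_ nC]] /=.
    by exists (p1 ++ p2); rewrite /oriented cat_path last_cat l1 xp1.
  by rewrite /Bin; case: asboolP => // _; rewrite mulr0.
apply: eq_fsbigr => -[x y] /[!inE] -[/= xz zy].
rewrite /Bin asboolT// (m2E conn f0fin f1fin fgh eS fac) (m3E conn f0fin f1fin fgh eS fac).
rewrite -/e -/M -/(U x) -/(D y) /F /G.
(* If [U x = 0], then [p 0 x = 0] as well, and both sides vanish. *)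
have [U0|U0] := eqVneq (U x) 0.
  have -> : p 0 x = 0 by exact: in_sum_eq0 conn f0fin f1fin eS fac _ U0.
  by rewrite U0 !mul0r.
have D0 : D y != 0 by exact: out_sum_neq0 conn f0fin f1fin eS fac y.
have [p1 [xp1 l1]] := xz; have [p2 [zp2 l2]] := zy.
have M0 : M x y != 0.
  rewrite gt_eqF//; apply: (path_sum_gt0 eS ed k0 (p := p1 ++ p2)).
  by split; rewrite ?cat_path ?last_cat l1 ?xp1.
have fact0 n : n`!%:R != 0 :> R by rewrite pnatr_eq0 -lt0n fact_gt0.
(* What remains is the cancellation of [U x], [D y], [M x y] and [d(x,y)!]. *)
rewrite natrM; field.
by rewrite !fact0 U0 D0 M0.
Qed.
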